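(* Suppose weights $\omega(\nwarrow^{s}\nearrow^{t})$, $s,t\in\mathbb{Z}$, are given, all but finitely many equal to $0$. For every $(k_1,\dots,k_n)\in\mathbb{Z}^n$, the signed generating function of generalized extended arrowed monotone triangles with bottom row $(k_1,\dots,k_n)$ equals $$\prod_{i=1}^n\sum_{s,t\in\mathbb{Z}}\omega(\nwarrow^{s}\nearrow^{t})X_i^{t-s}\prod_{1\le p<q\le n}\left(\sum_{s,t\in\mathbb{Z}}\omega(\nwarrow^{s}\nearrow^{t})E_{k_p}^{t}E_{k_q}^{-s}\right)s_{(k_n,\dots,k_1)}(X_1,\dots,X_n),$$ with the operator product expanded and applied to $(k_1,\dots,k_n)\mapsto s_{(k_n,\dots,k_1)}$ as a function on $\mathbb{Z}^n$ before evaluation.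
   Context: Signed interval for $a,b\in\mathbb{Z}$: $\langle a,b\rangle=([a,b],\emptyset)$ if $a\le b$; $(\emptyset,[b+1,a-1])$ if $b+1\le a-1$; $(\emptyset,\emptyset)$ if $b+1=a$; it is negative when its negative part is nonempty. A generalized extended arrowed monotone triangle is a triangular array $(a_{i,j})_{1\le j\le i\le n}$ of integers, each decorated with a symbol $\nwarrow^{s}\nearrow^{t}$, $s,t\in\mathbb{Z}$, such that for each $a=a_{i,j}$, $i<n$, with $b=a_{i+1,j}$ decorated $\nwarrow^{s_b}\nearrow^{t_b}$ and $c=a_{i+1,j+1}$ decorated $\nwarrow^{s_c}\nearrow^{t_c}$, one has $a\in\langle b+t_b,c-s_c\rangle$. Its sign is $(-1)^N$ with $N$ the number of pairs $(i,j)$, $2\le i\le n$, $j<i$, such that $\langle a_{i,j}+t_{a_{i,j}},a_{i,j+1}-s_{a_{i,j+1}}\rangle$ is negative. With $\alpha(\nwarrow^{s}\nearrow^{t})=t-s$, its weight is $\prod_{p,q}\omega(\nwarrow^{p}\nearrow^{q})^{\#\text{ of such decorations}}\prod_iX_i^{\sum_ja_{i,j}-\sum_ja_{i-1,j}+\sum_j\alpha(\mathrm{decor}(a_{i,j}))}$. $E_x$ is the shift $E_xp(x)=p(x+1)$. Extended Schur polynomial: for $\lambda\in\mathbb{Z}^n$, $s_\lambda=0$ if $\lambda_i-i=\lambda_j-j$ for some $i<j$; else with $\sigma$ such that $\lambda_{\sigma(1)}-\sigma(1)>\dots>\lambda_{\sigma(n)}-\sigma(n)$ and integer $p\ge0$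 with $\lambda_{\sigma(n)}+n-\sigma(n)+p\ge0$, $s_\lambda=\operatorname{sgn}(\sigma)s_\mu\prod X_i^{-p}$, $\mu_i=\lambda_{\sigma(i)}+i-\sigma(i)+p$. *)

(* Defs.v *)
(* All objects are evaluated pointwise in a field R:
   the variables X_1..X_n are the values X 0, ..., X (n-1) (nonzero),
   the weights omega(nw^s ne^t) are w s t. *)
From HB Require Import structures.
From mathcomp Require Import all_boot all_order all_algebra.
Set Implicit Arguments. Unset Strict Implicit. Unset Printing Implicit Defensive.
Import Order.TTheory GRing.Theory Num.Theory.
Local Open Scope ring_scope.

Definition zint (a b : int) : seq int :=
  if a <= b then mkseq (fun i : nat => a + i%:Z) (absz (b - a)).+1 else [::].

(* signed interval <a,b> = (positive part, negative part) *)
Definition sint (a b : int) : seq int * seq int :=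
  if a <= b then (zint a b, [::])
  else if b + 1 <= a - 1 then ([::], zint (b + 1) (a - 1))
  else ([::], [::]).

Definition in_sint (x a b : int) : bool :=
  (x \in (sint a b).1) || (x \in (sint a b).2).

Definition sint_neg (a b : int) : bool := (sint a b).2 != [::].

(* A decorated triangular array: T.1 = values, T.2 = decorations (s,t).
   Row i (0-indexed, i = 0..n-1) is row i+1 of the paper and has i+1 entries;
   entry j (0-indexed) of row i is a_{i+1,j+1}. *)
Definition triangle := (seq (seq int) * seq (seq (int * int)))%type.

Definition tval (T : triangle) (i j : nat) : int := nth 0 (nth [::] T.1 i) j.
Definition tdec (T : triangle) (i j : nat) : int * int := nth (0, 0) (nth [::] T.2 i) j.

Definition GEAMT (k : seq int) (T : triangle) : bool :=
  let n := size k in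
  [&& size T.1 == n, size T.2 == n,
   all (fun i => (size (nth [::] T.1 i) == i.+1) && (size (nth [::] T.2 i) == i.+1))
       (iota 0 n),
   nth [::] T.1 n.-1 == k &
   all (fun i => all (fun j =>
          in_sint (tval T i j)
                  (tval T i.+1 j + (tdec T i.+1 j).2)
                  (tval T i.+1 j.+1 - (tdec T i.+1 j.+1).1))
        (iota 0 i.+1)) (iota 0 n.-1)].

Definition supported (S : seq (int * int)) (n : nat) (T : triangle) : bool :=
  all (fun i => all (fun j => tdec T i j \in S) (iota 0 i.+1)) (iota 0 n).

Definition gsign (R : pzRingType) (n : nat) (T : triangle) : R :=
  (-1) ^+ (\sum_(1 <= i < n) \sum_(0 <= j < i)
             nat_of_bool (sint_neg (tval T i j + (tdec T i j).2)
                                   (tval T i j.+1 - (tdec T i j.+1).1)))%N.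

Definition rowsum (T : triangle) (i : nat) : int := \sum_(0 <= j < i.+1) tval T i j.
Definition prevsum (T : triangle) (i : nat) : int :=
  if i is i'.+1 then rowsum T i' else 0.
Definition alphasum (T : triangle) (i : nat) : int :=
  \sum_(0 <= j < i.+1) ((tdec T i j).2 - (tdec T i j).1).

Definition gweight (R : unitRingType) (w : int -> int -> R) (X : nat -> R)
  (n : nat) (T : triangle) : R :=
  (\prod_(0 <= i < n) \prod_(0 <= j < i.+1) w (tdec T i j).1 (tdec T i j).2) *
  \prod_(0 <= i < n) X i ^ (rowsum T i - prevsum T i + alphasum T i).

Definition gf_is (T : eqType) (R : nmodType) (P : pred T) (f : T -> R) (v : R) : Prop :=
  (exists L : seq T, uniq L /\ forall x, (x \in L) = P x) /\
  forall L : seq T, uniq L -> (forall x, (x \in L) = P x) -> \sum_(x <- L) f x = v.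

Fixpoint cprod (ls : seq (seq int)) : seq (seq int) :=
  if ls is l :: ls' then [seq x :: r | x <- l, r <- cprod ls'] else [:: [::]].

(* Gelfand-Tsetlin pattern formula: row of length m = lambda^(m); the rows
   below interlace: row_{j+1} <= nu_j <= row_j; weight X_m^{|row| - |nu|}. *)
Fixpoint gt_sum (R : unitRingType) (X : nat -> R) (m : nat) (row : seq int) : R :=
  if m is m'.+1 then
    \sum_(r <- cprod [seq zint (nth 0 row j.+1) (nth 0 row j) | j <- iota 0 m'])
       X m' ^ (\sum_(x <- row) x - \sum_(x <- r) x) * gt_sum X m' r
  else 1.

Definition schur (R : unitRingType) (X : nat -> R) (mu : seq int) : R :=
  gt_sum X (size mu) mu.

Definition ext_schur (R : unitRingType) (X : nat -> R) (lam : seq int) : R :=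
  let n := size lam in
  let v := [seq nth 0 lam i - (i.+1)%:Z | i <- iota 0 n] in
  if ~~ uniq v then 0 else
  let w := sort (fun a b : int => b <= a) v in
  let inv := (\sum_(0 <= i < n) \sum_(i.+1 <= j < n)
                 nat_of_bool (nth (0:int) v i < nth (0:int) v j)%R)%N in
  let p : int := Num.max 0 (- (nth 0 w n.-1 + n%:Z)) in
  let mu := [seq nth 0 w i + (i.+1)%:Z + p | i <- iota 0 n] in
  (-1) ^+ inv * schur X mu * \prod_(0 <= i < n) X i ^ (- p).

Definition addAt (k : seq int) (p : nat) (d : int) : seq int :=
  mkseq (fun j => nth 0 k j + (if j == p then d else 0)) (size k).

Definition pairOp (R : pzRingType) (S : seq (int * int)) (w : int -> int -> R)
  (p q : nat) (f : seq int -> R) : seq int -> R :=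
  fun k => \sum_(x <- undup S) w x.1 x.2 * f (addAt (addAt k p x.2) q (- x.1)).

Definition pairs (n : nat) : seq (nat * nat) :=
  [seq (p, q) | p <- iota 0 n, q <- iota p.+1 (n - p.+1)].

Definition opProd (R : pzRingType) (S : seq (int * int)) (w : int -> int -> R)
  (n : nat) (f : seq int -> R) : seq int -> R :=
  foldr (fun pq g => pairOp S w pq.1 pq.2 g) f (pairs n).

Definition rhs (R : unitRingType) (S : seq (int * int)) (w : int -> int -> R)
  (X : nat -> R) (k : seq int) : R :=
  let n := size k in
  (\prod_(0 <= i < n) \sum_(x <- undup S) w x.1 x.2 * X i ^ (x.2 - x.1)) *
  opProd S w n (fun k' => ext_schur X (rev k')) k.

(* Main.v *)
Require Import Defs.
From HB Require Import structures.
From mathcomp Require Import all_boot all_order all_algebra.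
From mathcomp Require Import ring zify.
Set Implicit Arguments. Unset Strict Implicit. Unset Printing Implicit Defensive.
Import Order.TTheory GRing.Theory Num.Theory.
Local Open Scope ring_scope.

(* Put K_j = k_j + j: the extended Schur polynomial becomes an alternating
   function of K, and the signed interval for the j-th entry of the row above
   becomes the half-open interval [K_j + t_j, K_(j+1) - s_(j+1)), signed.  The
   branching rule then reads: up to a power of X_n, the function for n variables
   is the alternating sum over i of a primitive H of X_n^(-|M|) times the
   function for n - 1 variables, evaluated at K with its i-th entry omitted.
   By induction the sum over the row above the bottom one is a difference, over
   the corners of a box, of F = Op H with Op the product of the W(E_p, E_q),
   where W(x, y) = sum w(s,t) X_n^(t-s) x^t y^(-s).  A corner using the same K_j
   in two adjacent coordinates contributes W(E_(j+1), E_j) F on the diagonal;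
   since W(E_(j+1), E_j) Op is symmetric in j, j+1 and H is alternating, this
   vanishes.  The remaining corners omit exactly one K_i, shift the entries
   before i by E^t and those after i by E^(-s), and these shifts are exactly what
   the factors of the larger operator product that involve i become on a function
   not depending on K_i. *)

(** * Finite linear functionals *)

Section FiniteFunctionals.
Variables (R : comNzRingType) (A : Type).
Implicit Types (P : A -> Prop) (Lam : (A -> R) -> R) (F G : A -> R).

(** All operators below are finite combinations of point evaluations. Recording this gives their
    linearity, and by [finlin_ext] an argument may be changed off the points satisfying [P], usually
    off the lists of one length, without functional extensionality. *)
Inductive finlin P : ((A -> R) -> R) -> Prop :=
| finlin_zero Lam : (forall F, Lam F = 0) -> finlin P Lam
| finlin_cons Lam c a Lam' : P a -> finlin P Lam' ->
    (forall F, Lam F = c * F a + Lam' F) -> finlin P Lam.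

Lemma finlin_ext P Lam F G :
  finlin P Lam -> (forall a, P a -> F a = G a) -> Lam F = Lam G.
Proof.
move=> L FG; elim: L => [L E|L c a L' Pa _ IH E]; first by rewrite !E.
by rewrite !E FG // IH.
Qed.

Lemma finlin_sum P Lam I (r : seq I) (c : I -> R) (F : I -> A -> R) :
  finlin P Lam ->
  Lam (fun a => \sum_(i <- r) c i * F i a) = \sum_(i <- r) c i * Lam (F i).
Proof.
elim=> [L E|L d a L' _ _ IH E].
  by rewrite E big1 // => i _; rewrite E mulr0.
rewrite E IH mulr_sumr -big_split /=.
by apply: eq_bigr => i _; rewrite E; ring.
Qed.

Lemma finlin_sub P Lam F G : finlin P Lam ->
  Lam (fun a => F a - G a) = Lam F - Lam G.
Proof.
elim=> [L E|L e a L' _ _ IH E]; first by rewrite !E; ring.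
by rewrite !E IH; ring.
Qed.

Lemma finlin_scale P Lam c F : finlin P Lam ->
  Lam (fun a => c * F a) = c * Lam F.
Proof.
elim=> [L E|L e a L' _ _ IH E]; first by rewrite !E; ring.
by rewrite !E IH; ring.
Qed.

Lemma finlin_opp P Lam F : finlin P Lam -> Lam (fun a => - F a) = - Lam F.
Proof.
elim=> [L E|L e a L' _ _ IH E]; first by rewrite !E; ring.
by rewrite !E IH; ring.
Qed.

Lemma finlin0 P Lam : finlin P Lam -> Lam (fun=> 0) = 0.
Proof. by elim=> [L E|L e a L' _ _ IH E]; rewrite E // IH; ring. Qed.

Lemma finlin_eval P a : P a -> finlin P (fun F => F a).
Proof.
move=> Pa; apply: (@finlin_cons P _ 1 a (fun=> 0)) => //.
  exact: finlin_zero.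
by move=> F; rewrite mul1r addr0.
Qed.

Lemma finlin_add P Lam Lam' c d : finlin P Lam -> finlin P Lam' ->
  finlin P (fun F => c * Lam F + d * Lam' F).
Proof.
move=> L L'; elim: L => [L1 E|L1 e a L2 Pa _ IH E].
  elim: L' => [L3 E'|L3 e a L4 Pa _ IH E'].
    by apply: finlin_zero => F; rewrite E E'; ring.
  by apply: (@finlin_cons P _ (d * e) a _ Pa IH) => F; rewrite E E'; ring.
by apply: (@finlin_cons P _ (c * e) a _ Pa IH) => F; rewrite E; ring.
Qed.

Lemma finlin_eq P Lam Lam' : finlin P Lam -> (forall F, Lam' F = Lam F) -> finlin P Lam'.
Proof.
case=> [L E E'|L c a L' Pa H E E'].
  by apply: finlin_zero => F; rewrite E' E.
by apply: (@finlin_cons P _ c a L' Pa H) => F; rewrite E' E.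
Qed.

Lemma finlin_bigsum P I (r : seq I) (c : I -> R) (Lam : I -> (A -> R) -> R) :
  (forall i, finlin P (Lam i)) -> finlin P (fun F => \sum_(i <- r) c i * Lam i F).
Proof.
move=> H; elim: r => [|i r IH].
  by apply: finlin_zero => F; rewrite big_nil.
apply: (finlin_eq (finlin_add (c i) 1 (H i) IH)) => F.
by rewrite big_cons mul1r.
Qed.

Lemma finlin_subr P Lam Lam' : finlin P Lam -> finlin P Lam' ->
  finlin P (fun F => Lam F - Lam' F).
Proof.
move=> L L'; apply: (finlin_eq (finlin_add 1 (-1) L L')) => F; ring.
Qed.

End FiniteFunctionals.

Lemma finlin_bind (R : comNzRingType) A B (P : A -> Prop) (Q : B -> Prop)
  (Lam : (A -> R) -> R) (M : A -> (B -> R) -> R) :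
  finlin P Lam -> (forall a, P a -> finlin Q (M a)) ->
  finlin Q (fun F => Lam (fun a => M a F)).
Proof.
move=> L H; elim: L => [L E|L c a L' Pa _ IH E].
  by apply: finlin_zero => F; rewrite E.
apply: (finlin_eq (finlin_add c 1 (H a Pa) IH)) => F.
by rewrite E mul1r.
Qed.

Lemma finlin_comp (R : comNzRingType) A B (P : A -> Prop) (Q : B -> Prop)
  (Lam : (A -> R) -> R) (phi : A -> B) :
  finlin P Lam -> (forall a, P a -> Q (phi a)) ->
  finlin Q (fun F => Lam (fun a => F (phi a))).
Proof.
move=> L H; apply: (finlin_bind L) => a Pa.
exact/finlin_eval/H.
Qed.

(** * Products of shift operators and corner differences *)

Section ShiftOperators.
Variables (R : comNzRingType) (U : seq (int * int)) (w : int * int -> R).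
Implicit Types (x y z a b : int) (K u v M : seq int) (F G H : seq int -> R).

(* [head_op x K F] applies prod_q W(E_x, E_q), q ranging over the entries of [K],
   to the function [F] of the head and the tail; W(E_p, E_q) stands for
   sum_(s,t) w(s,t) E_p^t E_q^-s throughout. *)
Fixpoint head_op x K (F : int * seq int -> R) : R :=
  if K is y :: K' then
    \sum_(d <- U) w d * head_op (x + d.2) K' (fun p => F (p.1, y - d.1 :: p.2))
  else F (x, [::]).

Fixpoint op_prod n F K : R :=
  if n is n'.+1 then
    if K is x :: K' then head_op x K' (fun p => op_prod n' (fun v => F (p.1 :: v)) p.2)
    else F [::]
  else F K.

Fixpoint shift_down K F : R :=
  if K is y :: K' then \sum_(d <- U) w d * shift_down K' (fun v => F (y - d.1 :: v))
  else F [::].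

(* sum over the position i of the missing entry, with sign (-1)^i, shifting the
   entries before i by E^t and those after i by E^-s *)
Fixpoint omit_shift K F : R :=
  if K is x :: K' then
    shift_down K' F - \sum_(d <- U) w d * omit_shift K' (fun v => F (x + d.2 :: v))
  else 0.

(* sum over the decorations of the entries of [K] of the differences over the
   corners of the box with sides [z, y - s), [y + t, y' - s'), ..., where z is
   the left end left over from the previous entry *)
Fixpoint deco_diff_from z K F : R :=
  if K is y :: K' then
    \sum_(d <- U) w d * (deco_diff_from (y + d.2) K' (fun v => F (y - d.1 :: v))
                         - deco_diff_from (y + d.2) K' (fun v => F (z :: v)))
  else F [::].

Definition deco_diff K F : R :=
  if K is x :: K' then \sum_(d <- U) w d * deco_diff_from (x + d.2) K' F else 0.

Lemma finlin_head_op x K :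
  finlin (fun p : int * seq int => size p.2 = size K) (head_op x K).
Proof.
elim: K x => [|y K IH] x /=; first exact: finlin_eval.
apply: finlin_bigsum => d.
by apply: (finlin_comp (phi := fun p : int * seq int => (p.1, y - d.1 :: p.2)) (IH _))
  => -[a v] /= ->.
Qed.

Lemma finlin_op_prod n K : size K = n ->
  finlin (fun v : seq int => size v = n) (fun F => op_prod n F K).
Proof.
elim: n K => [|n IH] [|x K] //=; first by move=> _; apply: finlin_eval.
case=> sK.
apply: (finlin_bind (finlin_head_op x K)) => -[a v] /= sv.
apply: (finlin_comp (phi := cons a) (IH v _)); first by rewrite sv.
by move=> v' /= ->.
Qed.

Lemma finlin_shift_down K : finlin (fun v : seq int => size v = size K) (shift_down K).
Proof.
elim: K => [|y K IH] /=; first exact: finlin_eval.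
apply: finlin_bigsum => d.
by apply: (finlin_comp (phi := cons (y - d.1)) IH) => v /= ->.
Qed.

Lemma finlin_omit_shift K : finlin (fun v : seq int => (size v).+1 = size K) (omit_shift K).
Proof.
elim: K => [|y K IH] /=; first exact: finlin_zero.
apply: finlin_subr.
  by apply: (finlin_comp (phi := id) (finlin_shift_down K)) => v ->.
apply: finlin_bigsum => d.
by apply: (finlin_comp (phi := cons (y + d.2)) IH) => v /= ->.
Qed.

Lemma finlin_deco_diff_from z K : finlin (fun v : seq int => size v = size K) (deco_diff_from z K).
Proof.
elim: K z => [|y K IH] z /=; first exact: finlin_eval.
apply: finlin_bigsum => d; apply: finlin_subr.
  by apply: (finlin_comp (phi := cons (y - d.1)) (IH _)) => v /= ->.
by apply: (finlin_comp (phi := cons z) (IH _)) => v /= ->.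
Qed.

Lemma mulr_sum_exchange (c e : int * int -> R) (f : int * int -> int * int -> R) :
  \sum_(i <- U) c i * (\sum_(j <- U) e j * f i j) =
  \sum_(j <- U) e j * (\sum_(i <- U) c i * f i j).
Proof.
under eq_bigr do rewrite mulr_sumr.
rewrite exchange_big /=; apply: eq_bigr => j _.
by rewrite mulr_sumr; apply: eq_bigr => i _; rewrite mulrCA.
Qed.

(** E_x^t fixes a function of the tail alone, so each factor W(E_x, E_q) keeps only its E_q^-s. *)
Lemma head_op_const x K F : head_op x K (fun p => F p.2) = shift_down K F.
Proof.
elim: K x F => [//|y K IH] x F /=.
by apply: eq_bigr => d _; rewrite -(IH (x + d.2)).
Qed.

Lemma head_op_shift_down x K (F : int * seq int -> R) :
  head_op x K (fun p => shift_down p.2 (fun v => F (p.1, v))) = shift_down K (fun v => head_op x v F).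
Proof.
elim: K x F => [//|y K IH] x F /=.
under eq_bigr => d _ do rewrite (finlin_sum _ _ _ (finlin_head_op _ _)).
rewrite mulr_sum_exchange; apply: eq_bigr => d _.
rewrite (finlin_sum _ _ _ (finlin_shift_down K)); congr (_ * _).
apply: eq_bigr => e _; congr (_ * _).
rewrite -(IH (x + e.2) (fun p => F (p.1, y - d.1 - e.1 :: p.2))) /=.
apply: (finlin_ext (finlin_head_op _ _)) => p _.
by rewrite addrAC.
Qed.

Lemma mulr_sum_reverse (f : int * int -> int * int -> int * int -> R) :
  \sum_(i <- U) w i * (\sum_(j <- U) w j * (\sum_(k <- U) w k * f i j k)) =
  \sum_(i <- U) w i * (\sum_(j <- U) w j * (\sum_(k <- U) w k * f k j i)).
Proof.
under eq_bigr => i _ do rewrite (mulr_sum_exchange w w (f i)).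
rewrite (mulr_sum_exchange w w (fun i k => \sum_(j <- U) w j * f i j k)).
apply: eq_bigr => i _; congr (_ * _).
exact: (mulr_sum_exchange w w (fun k j => f k j i)).
Qed.

(** [F] does not see the omitted entry, so the factor linking [x] to that entry keeps only E_x^t:
    this is the sum over [d]. All other factors commute with the shifts. *)
Lemma head_op_omit_shift x K (F : int * seq int -> R) :
  head_op x K (fun p => omit_shift p.2 (fun v => F (p.1, v))) =
  \sum_(d <- U) w d * omit_shift K (fun v => head_op (x + d.2) v F).
Proof.
elim: K x F => [|y K IH] x F /=; first by rewrite big1 // => d _; rewrite mulr0.
under eq_bigr => d _ do rewrite (finlin_sub _ _ (finlin_head_op _ _)) head_op_shift_down mulrBr
  (finlin_sum _ _ _ (finlin_head_op _ _)).
under [RHS]eq_bigr => d _ do rewrite mulrBr.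
rewrite !sumrB; congr (_ - _).
under eq_bigr => d _.
  under eq_bigr => e _ do rewrite (IH _ (fun p => F (p.1, y - d.1 + e.2 :: p.2))).
  over.
under [RHS]eq_bigr => d _.
  under eq_bigr => e _ do rewrite (finlin_sum _ _ _ (finlin_omit_shift _)).
  over.
rewrite mulr_sum_reverse; do 3!(apply: eq_bigr => ? _; congr (_ * _)).
apply: (finlin_ext (finlin_omit_shift _)) => v _.
rewrite addrAC; apply: (finlin_ext (finlin_head_op _ _)) => p _.
by rewrite addrAC.
Qed.

(** The pattern of a simplicial boundary: position i is deleted with sign (-1)^i. *)
Fixpoint omit_sum K F : R :=
  if K is x :: K' then F K' - omit_sum K' (fun v => F (x :: v)) else 0.

(** A factor involving the omitted entry keeps only the shift of its other entry: E^t if that entry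
    comes before, E^-s if it comes after. *)
Lemma op_prod_omit_sum n K F : size K = n ->
  op_prod n (fun v => omit_sum v F) K = omit_shift K (op_prod n.-1 F).
Proof.
elim: n K F => [|n IH] [|x K] F //= [] // sK.
(* The first term omits [x] itself, the second an entry of the tail. *)
transitivity (head_op x K (fun p => op_prod n F p.2)
  - head_op x K (fun p => omit_shift p.2 (op_prod n.-1 (fun v => F (p.1 :: v))))).
  rewrite -(finlin_sub _ _ (finlin_head_op _ _)).
  apply: (finlin_ext (finlin_head_op _ _)) => -[a v] /= sv.
  rewrite sK in sv.
  by rewrite (finlin_sub _ _ (finlin_op_prod sv)) IH.
rewrite head_op_const; congr (_ - _).
rewrite (head_op_omit_shift _ _ (fun p => op_prod n.-1 (fun v => F (p.1 :: v)) p.2)).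
apply: eq_bigr => d _; congr (_ * _).
apply: (finlin_ext (finlin_omit_shift _)) => v.
by rewrite sK => <-.
Qed.

(* the value of W(E_(j+1), E_j) F, where j is the position after [u] *)
Definition swap_step F u v a b : R := \sum_(d <- U) w d * F (u ++ a - d.1 :: b + d.2 :: v).

Lemma deco_diff_from_sum z K I (r : seq I) c (F : I -> seq int -> R) :
  deco_diff_from z K (fun v => \sum_(i <- r) c i * F i v) = \sum_(i <- r) c i * deco_diff_from z K (F i).
Proof. exact: (finlin_sum _ _ _ (finlin_deco_diff_from _ _)). Qed.

(* Two shifted copies of the same entry in adjacent positions cancel after
   summing over the decoration of that entry. *)
Lemma deco_diff_from_shift_down y K F :
  (forall u v a, (size (u ++ v)).+1 = size K -> swap_step F u v a a = 0) ->
  \sum_(d <- U) w d * deco_diff_from (y + d.2) K (fun v => F (y - d.1 :: v)) = shift_down (y :: K) F.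
Proof.
elim: K y F => [//|z K IH] y F HF.
rewrite [LHS]/=.
under eq_bigr => d _.
  under eq_bigr => e _ do rewrite mulrBr.
  rewrite sumrB (IH z (fun v => F (y - d.1 :: v))) /=; last first.
    by move=> u v a s; apply: (HF (_ :: u)); rewrite /= s.
  rewrite mulrBr; over.
(* The subtracted corners carry y - s and y + t of one decoration in adjacent positions; summed over
   [d] they form [swap_step] at equal arguments, which [HF] annihilates. *)
rewrite sumrB [X in _ - X]mulr_sum_exchange [X in _ - X]big1 ?subr0 // => e _.
rewrite -deco_diff_from_sum.
transitivity (w e * deco_diff_from (z + e.2) K (fun=> 0)); last first.
  by rewrite (finlin0 (finlin_deco_diff_from _ _)) mulr0.
congr (_ * _); apply: (finlin_ext (finlin_deco_diff_from _ _)) => v sv.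
by apply: (HF [::]); rewrite /= sv.
Qed.

(** The first coordinate of a corner is either y - s, so that [x] is omitted and all later
    coordinates are right ends, or x + t, and the omitted entry lies further on. The decoration of
    the omitted entry enters no coordinate, whence the factor [\sum_(d <- U) w d]. *)
Lemma deco_diff_omit_shift K F :
  (forall u v a, (size (u ++ v)).+3 = size K -> swap_step F u v a a = 0) ->
  deco_diff K F = (\sum_(d <- U) w d) * omit_shift K F.
Proof.
elim: K F => [|x K IH] F HF; first by rewrite /= mulr0.
case: K IH HF => [|y K] IH HF.
  rewrite /= [X in _ - X]big1 => [|d _]; last by rewrite mulr0.
  by rewrite subr0 mulr_suml.
rewrite [LHS]/=.
under eq_bigr => d _.
  under eq_bigr => e _ do rewrite mulrBr.
  rewrite sumrB deco_diff_from_shift_down ?mulrBr; last first.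
    by move=> u v a s; apply: HF; rewrite s.
  rewrite -[X in _ - w d * X]/(deco_diff (y :: K) (fun v => F (x + d.2 :: v))).
  rewrite IH; last by move=> u v a s; apply: (HF (_ :: u)); rewrite /= s.
  over.
rewrite sumrB -mulr_suml [in RHS]/= mulrBr; congr (_ - _).
by rewrite mulr_sumr; apply: eq_bigr => d _; rewrite mulrCA.
Qed.

End ShiftOperators.

(** * Alternating functions *)

Section Alternating.
Variable R : comNzRingType.
Implicit Types (A : int -> int -> R) (F G : seq int -> R) (u v K : seq int).

(* In characteristic 2 the second condition does not follow from the first. *)
Definition alt2 A := (forall a b, A a b = - A b a) /\ (forall a, A a a = 0).

Definition alt F := forall u v, alt2 (fun a b => F (u ++ a :: b :: v)).

Lemma alt2_ext A B : (forall a b, A a b = B a b) -> alt2 A -> alt2 B.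
Proof. by move=> E [H1 H2]; split=> *; rewrite -!E. Qed.

Lemma alt2_bigsum I (r : seq I) c (A : I -> int -> int -> R) :
  (forall i, alt2 (A i)) -> alt2 (fun a b => \sum_(i <- r) c i * A i a b).
Proof.
move=> H; split=> [a b|a].
  by rewrite -sumrN; apply: eq_bigr => i _; rewrite (proj1 (H i)) mulrN.
by rewrite big1 // => i _; rewrite (proj2 (H i)) mulr0.
Qed.

Lemma sum_alternating I (r : seq I) (T : I -> I -> R) :
  (forall i j, T i j = - T j i) -> (forall i, T i i = 0) ->
  \sum_(i <- r) \sum_(j <- r) T i j = 0.
Proof.
move=> T1 T0; elim: r => [|i r IH]; first by rewrite big_nil.
rewrite !big_cons T0 add0r.
under [X in _ + X]eq_bigr do rewrite big_cons T1.
by rewrite big_split /= IH addr0 sumrN subrr.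
Qed.

(** Exchanging [a] and [b] has the effect of exchanging the summation indices [i] and [j], up to the
    sign from [A]. Every symmetry of operator products below is reduced to this form. *)
Lemma alt2_bigsum2 I (r : seq I) (c : I -> I -> R) (A : I -> I -> int -> int -> R)
    (f : I -> I -> int) :
  (forall i j, c i j = c j i) -> (forall i j a b, A i j a b = A j i a b) ->
  (forall i j, alt2 (A i j)) ->
  alt2 (fun a b => \sum_(i <- r) \sum_(j <- r) c i j * A i j (a + f i j) (b + f j i)).
Proof.
move=> cC AC H; split=> [a b|a].
  rewrite exchange_big -sumrN; apply: eq_bigr => i _.
  rewrite -sumrN; apply: eq_bigr => j _.
  by rewrite cC AC (proj1 (H i j)) mulrN.
apply: sum_alternating => [i j|i]; last by rewrite (proj2 (H i i)) mulr0.
by rewrite cC AC (proj1 (H j i)) mulrN.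
Qed.

Lemma alt2_finlin B (P : B -> Prop) (Lam : (B -> R) -> R) (A : B -> int -> int -> R) :
  finlin P Lam -> (forall p, P p -> alt2 (A p)) ->
  alt2 (fun a b => Lam (fun p => A p a b)).
Proof.
move=> L H; split=> [a b|a].
  rewrite -(finlin_opp _ L); apply: (finlin_ext L) => p Pp.
  exact: (proj1 (H p Pp)).
rewrite -(finlin0 L); apply: (finlin_ext L) => p Pp.
exact: (proj2 (H p Pp)).
Qed.

Lemma alt_cons x F : alt F -> alt (fun v => F (x :: v)).
Proof. by move=> H u v; apply: (H (x :: u)). Qed.

Lemma finlin_omit_sum K : finlin (fun v => (size v).+1 = size K) (@omit_sum R K).
Proof.
elim: K => [|x K IH] /=; first exact: finlin_zero.
apply: finlin_subr; first exact: finlin_eval.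
by apply: (finlin_comp (phi := cons x) IH) => v /= ->.
Qed.

(** The two deletions inside the pair have opposite signs and are interchanged with [a] and [b];
    every other deletion keeps the pair and alternates because [F] does. *)
Lemma alt_omit_sum F : alt F -> alt (fun K => omit_sum K F).
Proof.
move=> H u v; elim: u F H => [|x u IH] F H /=.
  have [D1 D2] := alt2_finlin (finlin_omit_sum v) (fun z _ => H [::] z).
  by split=> [a b|a] /=; rewrite ?D2 ?subr0 ?subrr // D1; ring.
have [H1 H2] := H u v; have [I1 I2] := IH _ (alt_cons x H).
by split=> [a b|a] /=; rewrite ?H2 ?I2 ?subr0 // H1 I1 opprD.
Qed.

End Alternating.

(** * Operator products acting on alternating functions *)

Section AlternatingShift.
Variables (R : comNzRingType) (U : seq (int * int)) (w : int * int -> R).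
Implicit Types (x y a b : int) (F G : seq int -> R) (u v K : seq int).
Local Notation head_op := (head_op U w).
Local Notation op_prod := (op_prod U w).

(** For each later entry q the product W(E_a, E_q) W(E_b, E_q) is symmetric in the pair, so
    alternation is preserved. *)
Lemma alt2_head_op_pair v (F : int -> int -> seq int -> R) :
  (forall v', size v' = size v -> alt2 (fun a b => F a b v')) ->
  alt2 (fun a b => head_op a v (fun p => head_op b p.2 (fun q => F p.1 q.1 q.2))).
Proof.
elim: v F => [|y v IH] F H /=; first exact: (H [::]).
apply: (@alt2_ext _ (fun a b => \sum_(d <- U) \sum_(e <- U) (w d * w e) *
  head_op (a + d.2) v (fun p => head_op (b + e.2) p.2
    (fun q => F p.1 q.1 (y - d.1 - e.1 :: q.2))))).
  move=> a b; apply: eq_bigr => d _.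
  rewrite (finlin_sum _ _ _ (finlin_head_op _ _ _ _)) mulr_sumr.
  by apply: eq_bigr => e _; rewrite mulrA.
apply: (@alt2_bigsum2 _ _ _ (fun d e => w d * w e) (fun d e a b =>
  head_op a v (fun p => head_op b p.2 (fun q => F p.1 q.1 (y - d.1 - e.1 :: q.2))))
  (fun d _ => d.2)).
- by move=> i j; apply: mulrC.
- move=> i j a b; apply: (finlin_ext (finlin_head_op _ _ _ _)) => p _.
  by apply: (finlin_ext (finlin_head_op _ _ _ _)) => q _; rewrite addrAC.
- move=> i j; apply: (IH (fun a b v' => F a b (y - i.1 - j.1 :: v'))) => v' sv.
  by apply: H; rewrite /= sv.
Qed.

(** For an entry [x] before the pair, W(E_x, E_j) W(E_x, E_(j+1)) is symmetric in the two positions;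
    factors linking [x] to other entries act by linearity. *)
Lemma alt2_swap_step_head_op u v x (F : int * seq int -> R) :
  (forall x u' v', size u' = size u -> size v' = size v ->
    alt2 (swap_step U w (fun v => F (x, v)) u' v')) ->
  alt2 (swap_step U w (fun v => head_op x v F) u v).
Proof.
elim: u x F => [|y u IH] x F H.
  apply: (@alt2_ext _ (fun a b => \sum_(d <- U) \sum_(e <- U) (w d * w e) *
     head_op (x + d.2 + e.2) v (fun p => swap_step U w (fun v => F (p.1, v)) [::] p.2 (a - d.1) (b - e.1)))).
    move=> a b; rewrite /swap_step /=.
    under eq_bigr => d _ do under eq_bigr => e _ do
      rewrite (finlin_sum _ _ _ (finlin_head_op _ _ _ _)) -mulrA.
    under eq_bigr => d _ do rewrite -mulr_sumr mulr_sum_exchange.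
    rewrite mulr_sum_exchange; apply: eq_bigr => d _; congr (_ * _).
    do 2![apply: eq_bigr => ? _; congr (_ * _)].
    apply: (finlin_ext (finlin_head_op _ _ _ _)) => p _.
    by rewrite [a - _ - _]addrAC [b - _ + _]addrAC.
  apply: (@alt2_bigsum2 _ _ _ (fun d e => w d * w e) (fun d e a b =>
     head_op (x + d.2 + e.2) v (fun p => swap_step U w (fun v => F (p.1, v)) [::] p.2 a b))
     (fun d _ => - d.1)).
  - by move=> i j; apply: mulrC.
  - by move=> i j a b; rewrite addrAC.
  - move=> i j; apply: (alt2_finlin (finlin_head_op _ _ _ _)) => p sp; exact: H.
apply: (@alt2_ext _ (fun a b => \sum_(d <- U) w d *
   swap_step U w (fun v => head_op (x + d.2) v (fun p => F (p.1, y - d.1 :: p.2))) u v a b)).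
  move=> a b; rewrite /swap_step /=.
  exact: mulr_sum_exchange.
apply: alt2_bigsum => d; apply: IH => x' u' v' su sv.
by apply: (H _ (y - d.1 :: u')); rewrite /= ?su.
Qed.

(** The swap supplies W(E_(j+1), E_j), the mirror image of the factor W(E_j, E_(j+1)) of the
    product. Together they are symmetric in the pair, and so are the factors linking it to a third
    entry. *)
Lemma alt2_swap_step_op_prod n F u v : alt F -> (size (u ++ v)).+2 = n ->
  alt2 (swap_step U w (op_prod n F) u v).
Proof.
move E: (size u) => m; elim: m u v E n F => [|m IH] [|x u] v // E [|[|n]] F H // [sn].
  apply: (@alt2_ext _ (fun a b => \sum_(d <- U) \sum_(e <- U) (w d * w e) *
    head_op (a + (e.2 - d.1)) v (fun p => head_op (b + (d.2 - e.1)) p.2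
      (fun q => op_prod n (fun z => F [:: p.1, q.1 & z]) q.2)))).
    move=> a b; rewrite /swap_step /=.
    apply: eq_bigr => d _; rewrite mulr_sumr; apply: eq_bigr => e _.
    by rewrite -mulrA -!addrA [- d.1 + _]addrC.
  apply: (@alt2_bigsum2 _ _ _ (fun d e => w d * w e) (fun d e a b =>
    head_op a v (fun p => head_op b p.2
      (fun q => op_prod n (fun z => F [:: p.1, q.1 & z]) q.2)))
    (fun d e => e.2 - d.1)) => [i j|//|i j]; first exact: mulrC.
  apply: (alt2_head_op_pair (F := fun a b v => op_prod n (fun z => F [:: a, b & z]) v)).
  move=> v' sv; apply: (alt2_finlin (finlin_op_prod _ _ _)) => [|z _].
    by rewrite sv.
  exact: (H [::]).
apply: alt2_swap_step_head_op => x' u' v' su' sv.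
case: E => E; rewrite E in su'.
apply: (IH u' v' su' n.+1 (fun z => F (x' :: z))); first exact: alt_cons.
by rewrite -sn /= !size_cat su' sv E.
Qed.

End AlternatingShift.

(** * Signed sums over boxes *)

Fixpoint choices (T : Type) (ls : seq (seq T)) : seq (seq T) :=
  if ls is l :: ls' then [seq x :: r | x <- l, r <- choices ls'] else [:: [::]].

Lemma cprodE ls : cprod ls = choices ls.
Proof. by elim: ls => //= l ls ->. Qed.

(** Half-open between the smaller and the larger argument; the orientation is left to [ssum]. *)
Definition hrange (a b : int) : seq int :=
  if a <= b then mkseq (fun i : nat => a + i%:Z) (absz (b - a))
  else mkseq (fun i : nat => b + i%:Z) (absz (a - b)).

Section BoxSums.
Variable R : comNzRingType.
Implicit Types (x y z a b : int) (f : int -> R) (F G : seq int -> R).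
Implicit Types (u v K M : seq int) (I : seq (int * int)).

(* The sum over [a, b), counted negatively when b < a; thus the signed interval
   <a, b> corresponds to [ssum a (b + 1)]. *)
Definition ssum a b f : R := (if a <= b then 1 else -1) * \sum_(x <- hrange a b) f x.

Fixpoint box_sum I F : R :=
  if I is i :: I' then ssum i.1 i.2 (fun x => box_sum I' (fun v => F (x :: v)))
  else F [::].

Fixpoint box_diff I F : R :=
  if I is i :: I' then box_diff I' (fun v => F (i.2 :: v)) - box_diff I' (fun v => F (i.1 :: v))
  else F [::].

Fixpoint diff_all K F : R :=
  if K is x :: K' then diff_all K' (fun v => F (x + 1 :: v)) - diff_all K' (fun v => F (x :: v))
  else F [::].

(** A discrete antiderivative in every coordinate, based at 0 so that all coordinates are treated
    alike. *)
Definition box_prim F M : R := box_sum [seq (0, m) | m <- M] F.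

Lemma finlin_ssum a b : finlin (fun=> True) (ssum a b).
Proof.
apply: (finlin_eq (Lam := fun f => \sum_(x <- hrange a b) (if a <= b then 1 else -1) * f x)).
  by apply: finlin_bigsum => i; apply: finlin_eval.
by move=> f; rewrite /ssum mulr_sumr.
Qed.

Lemma finlin_box_sum I : finlin (fun v => size v = size I) (box_sum I).
Proof.
elim: I => [|i I IH] /=; first exact: finlin_eval.
apply: (finlin_bind (finlin_ssum i.1 i.2)) => x _.
by apply: (finlin_comp (phi := cons x) IH) => v /= ->.
Qed.

Lemma finlin_diff_all K : finlin (fun v => size v = size K) (diff_all K).
Proof.
elim: K => [|x K IH] /=; first exact: finlin_eval.
apply: finlin_subr.
  by apply: (finlin_comp (phi := cons (x + 1)) IH) => v /= ->.
by apply: (finlin_comp (phi := cons x) IH) => v /= ->.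
Qed.

Lemma ssum0 a f : ssum a a f = 0.
Proof. by rewrite /ssum /hrange lexx subrr big_nil mulr0. Qed.

(** For b < a the added term cancels one that was counted negatively, so the sign convention makes
    the recursion uniform on all integers. *)
Lemma ssumS a b f : ssum a (b + 1) f = ssum a b f + f b.
Proof.
rewrite /ssum /hrange; have [ab|ba] := leP a b.
  have -> : a <= b + 1 by lia.
  rewrite !mul1r (_ : absz (b + 1 - a : int)%R = (absz (b - a : int)%R).+1); last by lia.
  by rewrite mkseqS -cats1 big_cat big_seq1 /=; congr (_ + f _); lia.
rewrite (_ : absz (a - b : int)%R = (absz (a - (b + 1) : int)%R).+1); last by lia.
have [ab|ba'] := leP a (b + 1).
  have -> : a = b + 1 by lia.
  by rewrite subrr /= /mkseq /= big_nil big_seq1 addr0; ring.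
have E (c s : R) : -1 * (c + s) + c = -1 * s by ring.
rewrite /mkseq /= big_cons !big_map addr0 E.
rewrite -[1%N]/(1 + 0)%N iotaDl big_map; congr (_ * _).
by apply: eq_bigr => i _; congr f; lia.
Qed.

Lemma int_ind_from a (P : int -> Prop) :
  P a -> (forall b, P b <-> P (b + 1)) -> forall b, P b.
Proof.
move=> Pa H b; have -> : b = a + (b - a) by lia.
case: (b - a) => n; elim: n => [|n IH].
- by rewrite addr0.
- have -> : a + n.+1 = (a + n) + 1 :> int by lia.
  exact: (proj1 (H _)).
- by apply: (proj2 (H _)); rewrite NegzE subrK.
- by apply: (proj2 (H _)); have -> : a + Negz n.+1 + 1 = a + Negz n by lia.
Qed.

Lemma ssum_telescope a b f : ssum a b (fun x => f (x + 1) - f x) = f b - f a.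
Proof.
apply: (int_ind_from (a := a) (P := fun b => ssum a b _ = f b - f a)).
  by rewrite ssum0 subrr.
move=> {}b; rewrite ssumS; split=> [->|]; first by rewrite addrC addrA subrK.
by move/(congr1 (fun c : R => c - (f (b + 1) - f b))); rewrite addrK => ->; ring.
Qed.

Lemma ssum_shift a b c f : ssum (a + c) (b + c) f = ssum a b (fun x => f (x + c)).
Proof.
rewrite /ssum /hrange (_ : (a + c <= b + c) = (a <= b)); last by lia.
rewrite (_ : b + c - (a + c) = b - a); last by lia.
rewrite (_ : a + c - (b + c) = a - b); last by lia.
congr (_ * _); case: ifP => _; rewrite /mkseq !big_map;
by apply: eq_bigr => i _; rewrite addrAC.
Qed.

(** Both lower ends are 0, so exchanging [a] and [b] merely exchanges the two ranges and their
    signs. *)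
Lemma alt2_ssum (A : int -> int -> R) : alt2 A ->
  alt2 (fun a b => ssum 0 a (fun x => ssum 0 b (fun y => A x y))).
Proof.
move=> [H1 H2].
have E a b : ssum 0 a (fun x => ssum 0 b (fun y => A x y)) =
  (if 0 <= a then 1 else -1) * (if 0 <= b then 1 else -1) *
  \sum_(x <- hrange 0 a) \sum_(y <- hrange 0 b) A x y.
  by rewrite /ssum -mulrA; congr (_ * _); rewrite mulr_sumr.
split=> [a b|a]; rewrite !E; last by rewrite sum_alternating ?mulr0.
rewrite exchange_big [X in X * _ = _]mulrC -mulrN; congr (_ * _).
rewrite -sumrN; apply: eq_bigr => x _.
by rewrite -sumrN; apply: eq_bigr => y _.
Qed.

Lemma alt_box_prim F : alt F -> alt (box_prim F).
Proof.
move=> H u v; rewrite /box_prim; elim: u F H => [|x u IH] F H /=.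
  apply: (alt2_ssum (A := fun a b => box_sum [seq (0, m) | m <- v] (fun u => F [:: a, b & u]))).
  by apply: (alt2_finlin (finlin_box_sum _)) => z _; apply: (H [::]).
apply: (alt2_finlin (finlin_ssum 0 x)) => y _.
exact/IH/alt_cons.
Qed.

Lemma diff_all_box_prim K F : diff_all K (box_prim F) = F K.
Proof.
rewrite /box_prim; elim: K F => [//|x K IH] F /=.
rewrite -(finlin_sub _ _ (finlin_diff_all K)) -(IH (fun v => F (x :: v))).
apply: (finlin_ext (finlin_diff_all K)) => v _.
by rewrite ssumS addrC addKr.
Qed.

(** Telescoping in each coordinate in turn leaves only the corners. *)
Lemma box_sum_diff_all I F : box_sum I (fun v => diff_all v F) = box_diff I F.
Proof.
elim: I F => [//|i I IH] F /=.
rewrite -(ssum_telescope i.1 i.2 (fun x => box_diff I (fun v => F (x :: v)))).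
apply: (finlin_ext (finlin_ssum _ _)) => x _.
by rewrite (finlin_sub _ _ (finlin_box_sum _)) !IH.
Qed.

End BoxSums.

(** * Decorated rows and their boxes *)

Section Bottom.
Variables (R : comNzRingType) (U : seq (int * int)) (w : int * int -> R).
Implicit Types (x y z a b : int) (F G : seq int -> R) (u v K : seq int).
Local Notation head_op := (head_op U w).
Local Notation op_prod := (op_prod U w).

Lemma head_op_shift x (c : int) K (F : int * seq int -> R) : head_op (x + c) K F = head_op x K (fun p => F (p.1 + c, p.2)).
Proof.
elim: K x F => [//|y K IH] x F /=.
by apply: eq_bigr => d _; rewrite addrAC IH.
Qed.

Lemma head_op_diff_all x K (F : int * seq int -> R) :
  head_op x K (fun p => diff_all p.2 (fun v => F (p.1, v))) = diff_all K (fun v => head_op x v F).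
Proof.
elim: K x F => [//|y K IH] x F /=.
rewrite !(finlin_sum _ _ _ (finlin_diff_all R K)) -sumrB; apply: eq_bigr => d _.
rewrite -mulrBr -!IH -(finlin_sub _ _ (finlin_head_op _ _ _ _)); congr (_ * _).
apply: (finlin_ext (finlin_head_op _ _ _ _)) => p _ /=.
by rewrite addrAC.
Qed.

(** Shift operators with constant coefficients commute with forward differences. *)
Lemma op_prod_diff_all n K F : size K = n ->
  op_prod n (fun v => diff_all v F) K = diff_all K (op_prod n F).
Proof.
elim: n K F => [|n IH] [|x K] F //= [] // sK.
rewrite -(finlin_sub _ _ (finlin_diff_all R K)).
transitivity (head_op x K (fun p => diff_all p.2 (op_prod n (fun v => F (p.1 + 1 :: v))))
  - head_op x K (fun p => diff_all p.2 (op_prod n (fun v => F (p.1 :: v))))).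
  rewrite -(finlin_sub _ _ (finlin_head_op _ _ _ _)).
  apply: (finlin_ext (finlin_head_op _ _ _ _)) => -[a v] /= sv; rewrite sK in sv.
  by rewrite (finlin_sub _ _ (finlin_op_prod _ _ sv)) !IH.
rewrite (head_op_diff_all _ _ (fun p => op_prod n (fun v => F (p.1 :: v)) p.2)).
rewrite (head_op_diff_all _ _ (fun p => op_prod n (fun v => F (p.1 + 1 :: v)) p.2)).
rewrite -(finlin_sub _ _ (finlin_diff_all R K)).
apply: (finlin_ext (finlin_diff_all R K)) => v _.
by rewrite head_op_shift.
Qed.

(** [z] is the left end handed on by the preceding entry. The pairs are read as closed signed
    intervals in the coordinates k_j and as half-open ranges in the coordinates K_j. *)
Fixpoint deco_adj z K (e : seq (int * int)) : seq (int * int) :=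
  match K, e with
  | y :: K', d :: e' => (z, y - d.1) :: deco_adj (y + d.2) K' e'
  | _, _ => [::]
  end.

Lemma sum_box_diff_adj z K F :
  \sum_(e <- choices (nseq (size K) U)) (\prod_(d <- e) w d) * box_diff (deco_adj z K e) F =
  deco_diff_from U w z K F.
Proof.
elim: K z F => [|y K IH] z F /=; first by rewrite big_seq1 big_nil mul1r.
rewrite big_allpairs_dep; apply: eq_bigr => d _.
rewrite -!IH -sumrB mulr_sumr; apply: eq_bigr => e _.
by rewrite big_cons /=; ring.
Qed.

End Bottom.

(* the passage from k_j to k_j + j, under which the symmetry of the extended
   Schur polynomials becomes plain antisymmetry *)
Fixpoint shift_idx (c : int) (k : seq int) : seq int :=
  if k is x :: k' then x + c :: shift_idx (c + 1) k' else [::].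

Lemma size_shift_idx c k : size (shift_idx c k) = size k.
Proof. by elim: k c => //= x k IH c; rewrite IH. Qed.

Lemma sum_shift_idx c k :
  \sum_(x <- shift_idx c k) x = \sum_(x <- k) x + \sum_(i < size k) (c + i%:Z).
Proof.
elim: k c => [|x k IH] c /=; first by rewrite !big_nil big_ord0.
rewrite !big_cons IH big_ord_recl /= addr0.
have -> : \sum_(i < size k) (c + (bump 0 i)%:Z) = \sum_(i < size k) (c + 1 + i%:Z).
  by apply: eq_bigr => i _; rewrite /bump leq0n add1n intS addrA.
ring.
Qed.

Fixpoint adjacent z (K : seq int) : seq (int * int) :=
  if K is y :: K' then (z, y) :: adjacent y K' else [::].

Definition deco_intervals (k : seq int) (e : seq (int * int)) : seq (int * int) :=
  match k, e with
  | x :: k', d :: e' => deco_adj (x + d.2) k' e'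
  | _, _ => [::]
  end.

Lemma size_deco_intervals n k e :
  size k = n.+1 -> size e = n.+1 -> size (deco_intervals k e) = n.
Proof.
case: k e => [|x k] [|d e] // [sk] [se]; rewrite /= -sk.
have {n sk se} : size k = size e by rewrite sk.
elim: k (x + d.2) e => [|y k IH] z [|f e] //= [ske].
by rewrite IH.
Qed.

(** * The alternating Schur function and the recursive generating function *)

Section Gf.
Variables (R : fieldType) (X : nat -> R).
Implicit Types (x y z a b c : int) (F G : seq int -> R) (u v K k : seq int).

(* The value at n = 0 makes the function alternating on lists of every length. *)
Fixpoint alt_schur n K : R :=
  if n is m.+1 then
    X m ^ (\sum_(x <- K) x - m%:Z) *
    omit_sum K (box_prim (fun v => X m ^ (- \sum_(x <- v) x) * alt_schur m v))
  else (K == [::])%:R.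

Lemma alt_schurE n K : alt_schur n.+1 K = X n ^ (\sum_(x <- K) x - n%:Z) *
  omit_sum K (box_prim (fun v => X n ^ (- \sum_(x <- v) x) * alt_schur n v)).
Proof. by []. Qed.

Lemma alt_mul (c : seq int -> R) F :
  (forall u v a b, c (u ++ a :: b :: v) = c (u ++ b :: a :: v)) ->
  alt F -> alt (fun v => c v * F v).
Proof.
move=> cC H u v; have [H1 H2] := H u v.
by split=> [a b|a]; rewrite ?H2 ?mulr0 // H1 cC mulrN.
Qed.

Lemma sum_swap u v a b :
  \sum_(x <- u ++ a :: b :: v) x = \sum_(x <- u ++ b :: a :: v) x :> int.
Proof. by rewrite !big_cat !big_cons /=; congr (_ + _); rewrite addrCA. Qed.

Lemma alt_alt_schur n : alt (alt_schur n).
Proof.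
elim: n => [|n IH].
  by move=> [|x u] v; split=> [a b|a] /=; rewrite ?oppr0.
apply: alt_mul => [u v a b|]; first by rewrite sum_swap.
apply/alt_omit_sum/alt_box_prim/alt_mul => // u v a b; by rewrite sum_swap.
Qed.

(** A corner that uses an entry twice has two equal adjacent coordinates and vanishes; the remaining
    corners omit exactly one entry. *)
Lemma box_diff_adjacent z K F : alt F -> box_diff (adjacent z K) F = omit_sum (z :: K) F.
Proof.
elim: K z F => [|y K IH] z F H /=; first by rewrite subr0.
rewrite !IH /=; try exact: alt_cons.
have -> : omit_sum K (fun v => F [:: y, y & v]) = 0.
  have [_ D] := alt2_finlin (finlin_omit_sum _ K) (fun v _ => H [::] v).
  exact: D.
ring.
Qed.

(** This is the branching rule, for rows in any order: the alternating sum over deletions is the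
    corner difference of an antiderivative, hence a signed sum over the interlacing box. *)
Lemma alt_schurS n z K : size K = n ->
  alt_schur n.+1 (z :: K) = X n ^ (z + \sum_(x <- K) x - n%:Z) *
    box_sum (adjacent z K) (fun v => X n ^ (- \sum_(x <- v) x) * alt_schur n v).
Proof.
move=> sK; rewrite alt_schurE big_cons; congr (_ * _).
have aH : alt (fun v => X n ^ (- \sum_(x <- v) x) * alt_schur n v).
  by apply: alt_mul (alt_alt_schur n) => u v a b; rewrite sum_swap.
rewrite -box_diff_adjacent -?box_sum_diff_all; last exact: alt_box_prim.
by apply: (finlin_ext (finlin_box_sum _ _)) => v _; rewrite diff_all_box_prim.
Qed.

Lemma box_sum_shift I p F :
  box_sum [seq (i.1 + p, i.2 + p) | i <- I] F = box_sum I (fun v => F [seq x + p | x <- v]).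
Proof.
elim: I F => [//|i I IH] F /=; rewrite ssum_shift.
by apply: (finlin_ext (finlin_ssum _ _ _)) => x _; rewrite IH.
Qed.

(** Translating the row translates its interlacing box. The powers of [X n] coming from the [n]
    inner entries cancel, which leaves a single [X n ^ p]. *)
Lemma alt_schur_shift n K p : size K = n -> (forall i, (i < n)%N -> X i != 0) ->
  alt_schur n [seq x + p | x <- K] = \prod_(0 <= i < n) X i ^ p * alt_schur n K.
Proof.
elim: n K => [|n IH] [|z K] // sK X0; first by rewrite big_geq ?mul1r.
case: sK => sK; rewrite map_cons !alt_schurS ?size_map //.
have -> : adjacent (z + p) [seq x + p | x <- K] =
          [seq (i.1 + p, i.2 + p) | i <- adjacent z K].
  by elim: K {sK} z => //= y K IHK z; rewrite IHK.
have sumD v : \sum_(x <- [seq x + p | x <- v]) x = \sum_(x <- v) x + p * (size v)%:Z.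
  rewrite big_map big_split /=; congr (_ + _).
  by rewrite big_const_seq count_predT iter_addr_0 -mulr_natr natz.
have nz : X n != 0 by apply: X0.
rewrite box_sum_shift sumD sK.
have -> : box_sum (adjacent z K) (fun v => X n ^ (- (\sum_(x <- [seq x + p | x <- v]) x))
   * alt_schur n [seq x + p | x <- v]) = box_sum (adjacent z K) (fun v =>
   (X n ^ (- (p * n%:Z)) * \prod_(0 <= i < n) X i ^ p) *
   (X n ^ (- \sum_(x <- v) x) * alt_schur n v)).
  apply: (finlin_ext (finlin_box_sum _ _)) => v.
  have -> : size (adjacent z K) = n.
    by rewrite -sK; elim: (K) (z) => //= y K' IHK z'; rewrite IHK.
  move=> sv; rewrite sumD sv IH //; last by move=> i /ltnW; apply: X0.
  by rewrite opprD addrC expfzDr //; ring.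
rewrite (finlin_scale _ _ (finlin_box_sum _ _)) big_nat_recr //=.
have -> : z + p + (\sum_(x <- K) x + p * n%:Z) - n%:Z =
  (z + \sum_(x <- K) x - n%:Z) + p + p * n%:Z by ring.
rewrite (expfzDr _ _ nz) (expfzDr _ p nz) -(invr_expz _ (p * n%:Z)).
by field; apply: expfz_neq0.
Qed.

Variables (U : seq (int * int)) (w : int * int -> R).

(** Moving a power of [y] with exponent the sum of the entries past E_p^t E_q^-s costs y^(t - s).
    This depends on the decoration alone and is absorbed into its weight. *)
Lemma head_op_conj (y : R) x K (G : int * seq int -> R) : y != 0 ->
  head_op U w x K (fun p => y ^ (p.1 + \sum_(z <- p.2) z) * G p) =
  y ^ (x + \sum_(z <- K) z) * head_op U (fun d => w d * y ^ (d.2 - d.1)) x K G.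
Proof.
move=> y0; elim: K x G => [|z K IH] x G /=; first by rewrite big_nil.
rewrite mulr_sumr; apply: eq_bigr => d _.
transitivity (w d * head_op U w (x + d.2) K (fun p =>
   y ^ (p.1 + \sum_(z <- p.2) z) * (y ^ (z - d.1) * G (p.1, z - d.1 :: p.2)))).
  congr (_ * _); apply: (finlin_ext (finlin_head_op _ _ _ _)) => p _.
  by rewrite big_cons !(expfzDr _ _ y0); ring.
rewrite IH (finlin_scale _ _ (finlin_head_op _ _ _ _)) big_cons.
have -> : x + (z + \sum_(z <- K) z) = x + \sum_(z <- K) z + z by rewrite addrAC addrA.
have -> : x + d.2 + \sum_(z <- K) z = x + \sum_(z <- K) z + d.2 by rewrite addrAC.
rewrite !(expfzDr _ _ y0); ring.
Qed.

Lemma op_prod_conj (y : R) n K G : y != 0 -> size K = n ->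
  op_prod U w n (fun v => y ^ (\sum_(z <- v) z) * G v) K =
  y ^ (\sum_(z <- K) z) * op_prod U (fun d => w d * y ^ (d.2 - d.1)) n G K.
Proof.
move=> y0; elim: n K G => [|n IH] [|x K] G //= [sK].
rewrite big_cons -head_op_conj //.
apply: (finlin_ext (finlin_head_op _ _ _ _)) => -[a v] /= sv; rewrite sK in sv.
rewrite (expfzDr _ _ y0) -mulrA -IH // -(finlin_scale _ _ (finlin_op_prod _ _ sv)).
apply: (finlin_ext (finlin_op_prod _ _ sv)) => v' _.
by rewrite big_cons (expfzDr _ _ y0) mulrA.
Qed.

(** A right end belongs to the next entry and so moves by one more than the left end under k_j + j;
    this absorbs the + 1 that makes a closed interval half-open. *)
Lemma box_sum_shift_idx I0 z k e c F : I0 = deco_adj z k e ->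
  box_sum [seq (i.1, i.2 + 1) | i <- I0] (fun v => F (shift_idx c v)) =
  box_sum (deco_adj (z + c) (shift_idx (c + 1) k) e) F.
Proof.
move=> {I0}->; elim: k z e c F => [//|y k IH] z [//|d e] c F /=.
have -> : y + (c + 1) - d.1 = y - d.1 + 1 + c by ring.
rewrite ssum_shift; apply: (finlin_ext (finlin_ssum _ _ _)) => x _.
by rewrite (IH _ _ _ (fun v => F (x + c :: v))) [y + d.2 + _]addrAC.
Qed.

(** The bottom row is split off: its decorations are summed over, the row above runs through a
    signed box, and the exponent of [X m] is shared between the two rows. *)
Fixpoint gf_rec n k : R :=
  if n is m.+1 then
    \sum_(e <- choices (nseq n U))
      (\prod_(d <- e) w d) *
      X m ^ (\sum_(x <- k) x + \sum_(d <- e) (d.2 - d.1)) *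
      box_sum [seq (i.1, i.2 + 1) | i <- deco_intervals k e]
           (fun v => X m ^ (- \sum_(x <- v) x) * gf_rec m v)
  else 1.

Lemma sum_deco_diff K F x :
  \sum_(e <- choices (nseq (size K).+1 U)) (\prod_(d <- e) w d) *
     box_diff (deco_intervals (x :: K) e) F = deco_diff U w (x :: K) F.
Proof.
rewrite /= big_allpairs_dep; apply: eq_bigr => d _.
rewrite -sum_box_diff_adj mulr_sumr; apply: eq_bigr => e _.
by rewrite big_cons mulrA.
Qed.

End Gf.

(** * Evaluation of the recursive generating function *)

Section GfTheorem.
Variables (R : fieldType) (X : nat -> R) (U : seq (int * int)) (w : int * int -> R).
Implicit Types (x y z a b c : int) (F G : seq int -> R) (u v K k : seq int).

Local Notation wX n := (fun d => w d * X n ^ (d.2 - d.1)).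

(** Alternation of W(E_(j+1), E_j) applied to the operator product provides the vanishing needed by
    [deco_diff_omit_shift]. Then [op_prod_omit_sum] gathers the shifts into the product for one more
    entry, and conjugation by a power of [X n] restores the weights [w]. *)
Lemma deco_diff_op_prod n K : X n != 0 -> size K = n.+1 ->
  X n ^ (\sum_(x <- K) x - n%:Z) *
  deco_diff U (wX n) K (op_prod U (wX n) n (box_prim (fun v => X n ^ (- \sum_(x <- v) x) * alt_schur X n v))) =
  (\sum_(d <- U) wX n d) * op_prod U w n.+1 (alt_schur X n.+1) K.
Proof.
move=> nz sK; set B := box_prim _.
have aB : alt B.
  by apply/alt_box_prim/alt_mul/alt_alt_schur => u v a b; rewrite sum_swap.
rewrite deco_diff_omit_shift => [|u v a suv]; last first.
  apply: (proj2 (alt2_swap_step_op_prod _ _ aB _)).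
  by move: suv; rewrite sK => -[].
rewrite mulrCA; congr (_ * _).
rewrite -[op_prod _ (wX n) _ _]/(op_prod U (wX n) n.+1.-1 B) -op_prod_omit_sum //.
rewrite (expfzDr _ _ nz) mulrAC -op_prod_conj // mulrC.
rewrite -(finlin_scale _ _ (finlin_op_prod _ _ sK)).
apply: (finlin_ext (finlin_op_prod _ _ sK)) => v _.
by rewrite alt_schurE (expfzDr _ _ nz) -/B; ring.
Qed.

Lemma prod_wX n (e : seq (int * int)) : X n != 0 ->
  \prod_(d <- e) wX n d = (\prod_(d <- e) w d) * X n ^ (\sum_(d <- e) (d.2 - d.1)).
Proof.
move=> nz; elim: e => [|d e IH]; first by rewrite !big_nil mulr1.
by rewrite !big_cons IH (expfzDr (d.2 - d.1) _ nz); ring.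
Qed.

(** The summand over the row above the bottom one thereby becomes a total difference, so that its
    box sum reduces to corners. *)
Lemma op_prod_alt_schur_diff n K : X n != 0 -> size K = n ->
  X n ^ (- \sum_(x <- K) x) * op_prod U w n (alt_schur X n) K =
  diff_all K (op_prod U (wX n) n (box_prim (fun v => X n ^ (- \sum_(x <- v) x) * alt_schur X n v))).
Proof.
move=> nz sK; rewrite -op_prod_diff_all //.
have -> : op_prod U w n (alt_schur X n) K = op_prod U w n (fun v => X n ^ (\sum_(x <- v) x) *
    (X n ^ (- \sum_(x <- v) x) * alt_schur X n v)) K.
  apply: (finlin_ext (finlin_op_prod _ _ sK)) => v _.
  by rewrite mulrA -(expfzDr _ _ nz) addrN mul1r.
rewrite op_prod_conj // mulrA -(expfzDr _ _ nz) addNr mul1r.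
by apply: (finlin_ext (finlin_op_prod _ _ sK)) => v _; rewrite diff_all_box_prim.
Qed.

Lemma size_choices (T : eqType) (ls : seq (seq T)) e : e \in choices ls -> size e = size ls.
Proof.
elim: ls e => [|l ls IH] e /=; first by rewrite inE => /eqP->.
by case/allpairsPdep => x [r [_ /IH <- ->]].
Qed.

Lemma gf_rec_op_prod n k : size k = n -> (forall i, (i < n)%N -> X i != 0) ->
  gf_rec X U w n k = (\prod_(0 <= i < n) \sum_(d <- U) wX i d) * op_prod U w n (alt_schur X n) (shift_idx 0 k).
Proof.
elim: n k => [|n IH] k sk X0.
  by case: k sk => // _; rewrite big_geq //= mul1r.
rewrite big_nat_recr // -[RHS]mulrA.
have nz : X n != 0 by apply: X0.
have sK : size (shift_idx 0 k) = n.+1 by rewrite size_shift_idx sk.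
rewrite -deco_diff_op_prod //; set C := \prod_(0 <= i < n) _; set F := op_prod _ _ _ (box_prim _).
case: k sk sK => // x k [sk] sK.
rewrite [shift_idx 0 _]/= -sum_deco_diff size_shift_idx sk !mulr_sumr [LHS]/=.
rewrite -[X in \sum_(e <- X) _]/(choices (nseq n.+1 U)).
apply: eq_big_seq => e /size_choices; rewrite size_nseq; case: e => [|d e] // [se].
(* The total index shift 0 + 1 + ... + (n - 1) of the row above, which has [n] entries. *)
set N := \sum_(i < n) (0 + i%:Z : int).
transitivity ((\prod_(d0 <- d :: e) w d0) *
  X n ^ (\sum_(z <- x :: k) z + \sum_(d0 <- d :: e) (d0.2 - d0.1)) *
  (C * X n ^ N * box_diff (deco_intervals (x + 0 :: shift_idx (0 + 1) k) (d :: e)) F)).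
  congr (_ * _).
  rewrite -box_sum_diff_all /= addrAC -(box_sum_shift_idx 0 (fun v => diff_all v F) (erefl _)).
  rewrite -(finlin_scale _ _ (finlin_box_sum _ _)).
  apply: (finlin_ext (finlin_box_sum _ _)) => v.
  rewrite size_map -[deco_adj _ _ _]/(deco_intervals (x :: k) (d :: e)).
  rewrite (size_deco_intervals (n := n)) /= ?sk ?se // => sv.
  rewrite IH // => [|i /ltnW]; last exact: X0.
  rewrite -op_prod_alt_schur_diff ?size_shift_idx // -/C.
  rewrite sum_shift_idx sv -/N opprD [in RHS](expfzDr _ _ nz) -(invr_expz _ N).
  by field; apply: expfz_neq0.
rewrite prod_wX // (expfzDr _ _ nz).
(* The bottom row has one more entry, of index n; its shift cancels the [- n%:Z] in the exponent of
   [alt_schur]. *)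
have -> : \sum_(z <- x + 0 :: shift_idx (0 + 1) k) z = \sum_(z <- x :: k) z + N + n%:Z.
  by rewrite -[_ :: _]/(shift_idx 0 (x :: k)) sum_shift_idx /= sk big_ord_recr /= add0r addrA.
rewrite addrK (expfzDr _ _ nz); ring.
Qed.

End GfTheorem.

(** * Enumeration of the triangles *)

Definition sint_list (i : int * int) : seq int := (sint i.1 i.2).1 ++ (sint i.1 i.2).2.

Lemma mem_sint_list x i : (x \in sint_list i) = in_sint x i.1 i.2.
Proof. by rewrite mem_cat. Qed.

Lemma uniq_zint a b : uniq (zint a b).
Proof.
rewrite /zint; case: ifP => // _.
by rewrite map_inj_uniq ?iota_uniq // => i j /addrI [].
Qed.

Lemma uniq_sint_list i : uniq (sint_list i).
Proof.
rewrite /sint_list /sint; case: ifP => _; first by rewrite cats0 uniq_zint.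
by case: ifP => _ //=; rewrite uniq_zint.
Qed.

Lemma mem_choices (T : eqType) x0 (ls : seq (seq T)) e :
  (e \in choices ls) =
  (size e == size ls) && all (fun j => nth x0 e j \in nth [::] ls j) (iota 0 (size ls)).
Proof.
elim: ls e => [|l ls IH] [|x e] //=.
  by apply/negbTE/allpairsPdep => -[? [? []]].
rewrite eqSS -[1%N]addn0 iotaDl all_map.
rewrite (eq_all (a2 := fun j => nth x0 e j \in nth [::] ls j)) //.
rewrite andbCA -IH; apply/allpairsPdep/andP => [[y [r [? ? [-> ->]]]]//|[xl el]].
by exists x, e.
Qed.

Lemma uniq_choices (T : eqType) (ls : seq (seq T)) : all uniq ls -> uniq (choices ls).
Proof.
elim: ls => //= l ls IH /andP[ul /IH uls].
by apply: allpairs_uniq => // -[a b] [c d] _ _ [-> ->].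
Qed.

Lemma nth_deco_intervals k e j : size k = size e -> (j.+1 < size k)%N ->
  nth (0, 0) (deco_intervals k e) j =
  (nth 0 k j + (nth (0, 0) e j).2, nth 0 k j.+1 - (nth (0, 0) e j.+1).1).
Proof.
case: k e => [|x k] [|d e] //= [].
elim: k x d e j => [|y k IH] x d [|f e] // [|j] //= [ske] jk.
by rewrite -(IH y).
Qed.

Lemma hrange_zint a b :
  hrange a (b + 1) = if a <= b + 1 then zint a b else zint (b + 1) (a - 1).
Proof.
rewrite /hrange /zint; have [ab|ba] := leP a b.
  have -> : a <= b + 1 by lia.
  by congr mkseq; lia.
have [ab|ba'] := leP a (b + 1).
  by have -> : a = b + 1; [lia | rewrite subrr].
have -> : b + 1 <= a - 1 by lia.
by congr mkseq; lia.
Qed.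

Section Triangles.
Variables (R : fieldType) (X : nat -> R) (S : seq (int * int)) (w : int -> int -> R).
Local Notation U := (undup S).
Local Notation wt := (fun d : int * int => w d.1 d.2).
Implicit Types (T : triangle) (k a : seq int) (e : seq (int * int)).

(** A positive interval is a forward range and a negative one a reversed range counted with -1; for
    l = r + 1 both sums are empty. *)
Lemma sum_sint_list i f :
  (-1) ^+ sint_neg i.1 i.2 * \sum_(x <- sint_list i) f x = ssum i.1 (i.2 + 1) f :> R.
Proof.
case: i => l r /=; rewrite /sint_neg /sint_list /ssum /sint /= hrange_zint.
have [lr|rl] := leP l r.
  have -> : l <= r + 1 by lia.
  by rewrite /= cats0.
have [rl2|lr2] := leP (r + 1) (l - 1).
  have -> : (l <= r + 1) = false by lia.
  by rewrite /= {1}/zint rl2.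
have -> : l = r + 1 by lia.
by rewrite lexx /= /zint ifF ?big_nil ?mulr0 //; lia.
Qed.

Lemma sum_choices_sint_list I (F : seq int -> R) :
  (-1) ^+ (\sum_(i <- I) sint_neg i.1 i.2)%N * \sum_(a <- choices (map sint_list I)) F a =
  box_sum [seq (i.1, i.2 + 1) | i <- I] F.
Proof.
elim: I F => [|i I IH] F /=; first by rewrite !big_nil big_seq1 mul1r.
rewrite big_cons exprD big_allpairs_dep -sum_sint_list -mulrA; congr (_ * _).
by rewrite mulr_sumr; apply: eq_bigr => x _; rewrite IH.
Qed.

(** An explicit enumeration, built from the bottom row upwards so that its recursion is that of
    [gf_rec]; it also witnesses finiteness. *)
Fixpoint triangles n k : seq triangle :=
  if n is m.+1 then
    [seq (rcons T.1 k, rcons T.2 e) | e <- choices (nseq n U),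
       T <- [seq T | a <- choices (map sint_list (deco_intervals k e)), T <- triangles m a]]
  else [:: ([::], [::])].

Definition geamt_spec n k T : Prop :=
  [/\ size T.1 = n, size T.2 = n,
      forall i, (i < n)%N -> size (nth [::] T.1 i) = i.+1 /\ size (nth [::] T.2 i) = i.+1,
      nth [::] T.1 n.-1 = k &
      (forall i j, (i.+1 < n)%N -> (j <= i)%N ->
          in_sint (Defs.tval T i j)
                  (Defs.tval T i.+1 j + (tdec T i.+1 j).2)
                  (Defs.tval T i.+1 j.+1 - (tdec T i.+1 j.+1).1)) /\
      (forall i j, (i < n)%N -> (j <= i)%N -> tdec T i j \in S)].

Lemma geamt_specP n k T : size k = n ->
  reflect (geamt_spec n k T) (GEAMT k T && supported S n T).
Proof.
move=> sk; rewrite /GEAMT /supported sk.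
apply: (iffP idP) => [/andP[/and5P[/eqP s1 /eqP s2 /allP s3 /eqP s4 /allP s5] /allP s6]|].
  split=> //.
    move=> i li; have := s3 i; rewrite mem_iota => /(_ li).
    by case/andP => /eqP-> /eqP->.
  split=> i j li ji.
    have ii : i \in iota 0 n.-1 by rewrite mem_iota; lia.
    by apply: (allP (s5 i ii) j); rewrite mem_iota.
  have ii : i \in iota 0 n by rewrite mem_iota.
  by apply: (allP (s6 i ii) j); rewrite mem_iota.
case=> s1 s2 s3 s4 [s5 s6]; rewrite s1 s2 s4 !eqxx.
apply/andP; split; first (apply/and5P; split) => //.
- by apply/allP => i; rewrite mem_iota => /s3 [-> ->]; rewrite !eqxx.
- apply/allP => i; rewrite mem_iota => li; apply/allP => j; rewrite mem_iota => lj.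
  by apply: s5 => //; lia.
- apply/allP => i; rewrite mem_iota => li; apply/allP => j; rewrite mem_iota => lj.
  exact: s6.
Qed.

Lemma tval_rcons T k e i j : Defs.tval (rcons T.1 k, rcons T.2 e) i j =
  if (i < size T.1)%N then Defs.tval T i j else if i == size T.1 then nth 0 k j else 0.
Proof.
rewrite /Defs.tval nth_rcons; case: ifP => // _; case: ifP => // _.
by rewrite nth_nil.
Qed.

Lemma tdec_rcons T k e i j : tdec (rcons T.1 k, rcons T.2 e) i j =
  if (i < size T.2)%N then tdec T i j
  else if i == size T.2 then nth (0, 0) e j else (0, 0).
Proof.
rewrite /tdec nth_rcons; case: ifP => // _; case: ifP => // _.
by rewrite nth_nil.
Qed.

Lemma geamt_spec_rcons n k T e : size k = n.+1 ->
  geamt_spec n.+1 k (rcons T.1 k, rcons T.2 e) <->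
  exists a, [/\ e \in choices (nseq n.+1 U),
                a \in choices (map sint_list (deco_intervals k e)), size a = n & geamt_spec n a T].
Proof.
set x0 : triangle := (rcons T.1 k, rcons T.2 e).
move=> sk; split=> [[s1 s2 s3 s4 [s5 s6]]|[a [he ha sa [s1 s2 s3 s4 [s5 s6]]]]].
  have {}s1 : size T.1 = n by move: s1; rewrite size_rcons => -[].
  have {}s2 : size T.2 = n by move: s2; rewrite size_rcons => -[].
  have se : size e = n.+1.
    by have [_] := s3 n (ltnSn n); rewrite /= nth_rcons s2 ltnn eqxx.
  (* The last row of [T]; for n = 0 it is the default [[::]], which has the right length. *)
  exists (nth [::] T.1 n.-1).
  have sa : size (nth [::] T.1 n.-1) = n.
    case: n s1 s3 {s2 s4 s5 s6 se sk} => [|n] s1 s3; first by case: (T.1) s1.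
    by have [] := s3 n (leqnSn _); rewrite /= nth_rcons s1 ltnSn.
  have sd : size (deco_intervals k e) = n by apply: size_deco_intervals.
  split=> //.
  - rewrite (mem_choices (0, 0)) size_nseq se eqxx; apply/allP => j; rewrite mem_iota => lj.
    rewrite nth_nseq ifT // mem_undup.
    have := s6 n j (ltnSn n); rewrite tdec_rcons s2 ltnn eqxx; apply; lia.
  - rewrite (mem_choices 0) size_map sd sa eqxx; apply/allP => j; rewrite mem_iota => lj.
    rewrite (nth_map (0, 0)) ?sd // mem_sint_list nth_deco_intervals ?sk ?se //=.
    have := s5 n.-1 j; rewrite !tval_rcons !tdec_rcons s1 s2.
    have -> : n.-1.+1 = n by lia.
    rewrite ltnn eqxx ifT; last lia.
    apply; lia.
  - split=> //.
    + move=> i li; have [] := s3 i (ltnW li).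
      by rewrite /= !nth_rcons s1 s2 li.
    + split=> i j li ji.
        have := s5 i j (ltnW li) ji; rewrite !tval_rcons !tdec_rcons s1 s2 li ifT //.
        exact: ltnW.
      by have := s6 i j (ltnW li) ji; rewrite tdec_rcons s2 li.
have se : size e = n.+1 by rewrite (size_choices he) size_nseq.
have sd : size (deco_intervals k e) = n by apply: size_deco_intervals.
split; rewrite /= ?size_rcons ?s1 ?s2 //.
- move=> i; rewrite ltnS leq_eqVlt => /orP[/eqP ->|li].
    by rewrite !nth_rcons s1 s2 ltnn eqxx sk se.
  by rewrite !nth_rcons s1 s2 li; apply: s3.
- by rewrite nth_rcons s1 ltnn eqxx.
- split=> i j li ji.
    rewrite !tval_rcons !tdec_rcons s1 s2.
    have li' : (i < n)%N by lia.
    rewrite li'; case: (ltnP i.+1 n) => li2; first exact: s5.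
    have ei : i.+1 = n by lia.
    rewrite ei eqxx.
    move: ha; rewrite (mem_choices 0) => /andP[_ /allP /(_ j)].
    rewrite mem_iota size_map sd (nth_map (0, 0)) ?sd; last lia.
    rewrite mem_sint_list nth_deco_intervals ?sk ?se //=; last lia.
    have s4' : nth [::] T.1 i = a by rewrite -s4 -ei.
    by rewrite /Defs.tval s4'; apply; lia.
  rewrite tdec_rcons s2; case: (ltnP i n) => li2; first exact: s6.
  have -> : i = n by lia.
  rewrite eqxx; move: he; rewrite (mem_choices (0, 0)) => /andP[_ /allP /(_ j)].
  rewrite mem_iota size_nseq nth_nseq ifT; last lia.
  by rewrite mem_undup; apply; lia.
Qed.

Lemma mem_triangles n k T : size k = n -> (T \in triangles n k) = GEAMT k T && supported S n T.
Proof.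
elim: n k T => [|n IH] k T sk.
  apply/idP/(geamt_specP _ sk) => [|[/size0nil s1 /size0nil s2 _ _ _]].
    rewrite inE => /eqP->; split=> //=.
    by case: (k) sk.
  by rewrite inE; case: T s1 s2 => /= ? ? -> ->.
apply/allpairsPdep/(geamt_specP _ sk) => [[e [T' [he /allpairsPdep[a [T'' [ha hT'' ->]]] ->]]]|].
  have sa : size a = n.
    rewrite (size_choices ha) size_map; apply: size_deco_intervals => //.
    by rewrite (size_choices he) size_nseq.
  apply/geamt_spec_rcons => //; exists a; split=> //.
  by apply/geamt_specP => //; rewrite -IH.
case: T => V D g.
have [s1 s2 _ g4 _] := g; rewrite /= in s1 s2 g4.
case/lastP: V s1 g4 g => // V k'; rewrite size_rcons => -[s1].
rewrite nth_rcons s1 ltnn eqxx => ->.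
case/lastP: D s2 => // D e; rewrite size_rcons => -[s2] g.
have /(geamt_spec_rcons (V, D)) : geamt_spec n.+1 k (rcons (V, D).1 k, rcons (V, D).2 e) by [].
case=> // a [he ha sa g'].
exists e, (V, D); split=> //.
by apply/allpairsPdep; exists a, (V, D); split=> //; rewrite IH //; apply/geamt_specP.
Qed.

Lemma uniq_triangles n k : size k = n -> uniq (triangles n k).
Proof.
elim: n k => [//|n IH] k sk.
have uU : uniq (choices (nseq n.+1 U)).
  by apply: uniq_choices; rewrite all_nseq undup_uniq orbT.
have sa e a : e \in choices (nseq n.+1 U) ->
    a \in choices (map sint_list (deco_intervals k e)) -> size a = n.
  move=> he ha; rewrite (size_choices ha) size_map; apply: size_deco_intervals => //.
  by rewrite (size_choices he) size_nseq.
apply: allpairs_uniq_dep => //.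
  move=> e he; apply: allpairs_uniq_dep.
  - apply: uniq_choices; rewrite all_map; apply/allP => i _; exact: uniq_sint_list.
  - by move=> a ha; apply: IH; apply: sa ha.
  (* [T] determines [a] as its last row, so different [a] contribute disjoint lists. *)
  - move=> _ _ /allpairsPdep[a [T [ha hT ->]]] /allpairsPdep[a' [T' [ha' hT' ->]]] /= E.
    rewrite -E in hT' *.
    move: hT hT'; rewrite !mem_triangles ?(sa e) // => /geamt_specP [|_ _ _ E1 _]; first exact: sa ha.
    by move=> /geamt_specP [|_ _ _ E2 _]; [exact: sa ha' | rewrite -E1 -E2].
move=> _ _ /allpairsPdep[e [T [_ _ ->]]] /allpairsPdep[e' [T' [_ _ ->]]] /=.
case: T T' => V D [V' D'] /= [/rcons_inj[->] /rcons_inj[-> ->]] //.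
Qed.

Lemma gsign_rcons n k e T : size k = n.+1 -> size e = n.+1 ->
  size T.1 = n -> size T.2 = n ->
  gsign R n.+1 (rcons T.1 k, rcons T.2 e) =
  gsign R n T * (-1) ^+ (\sum_(i <- deco_intervals k e) sint_neg i.1 i.2)%N.
Proof.
move=> sk se s1 s2; rewrite /gsign -exprD.
have -> : (\sum_(i <- deco_intervals k e) sint_neg i.1 i.2 =
    \sum_(0 <= j < n) sint_neg (nth 0 k j + (nth (0, 0) e j).2)%R
      (nth 0 k j.+1 - (nth (0, 0) e j.+1).1)%R)%N.
  have sd : size (deco_intervals k e) = n by apply: size_deco_intervals.
  rewrite (big_nth (0, 0)) sd; apply: eq_big_nat => j /andP[_ lj].
  by rewrite nth_deco_intervals ?sk ?se.
case: n sk se s1 s2 => [|n] sk se s1 s2; first by rewrite !big_geq.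
rewrite big_nat_recr //=; congr (_ ^+ (_ + _)).
  apply: eq_big_nat => i /andP[_ li]; apply: eq_bigr => j _.
  by rewrite !tval_rcons !tdec_rcons s1 s2 li.
by apply: eq_bigr => j _; rewrite !tval_rcons !tdec_rcons s1 s2 ltnn eqxx.
Qed.

Lemma gweight_rcons n k e a T : X n != 0 -> size k = n.+1 -> size e = n.+1 ->
  size a = n -> size T.1 = n -> size T.2 = n -> nth [::] T.1 n.-1 = a ->
  gweight w X n.+1 (rcons T.1 k, rcons T.2 e) =
  (\prod_(d <- e) w d.1 d.2) * X n ^ (\sum_(x <- k) x + \sum_(d <- e) (d.2 - d.1)) *
  (X n ^ (- \sum_(x <- a) x) * gweight w X n T).
Proof.
move=> nz sk se sa s1 s2 Ea; rewrite /gweight.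
rewrite [X in X * _ = _]big_nat_recr // [X in _ * X = _]big_nat_recr //=.
set T' : triangle := (_, _).
have Er i : (i < n)%N -> rowsum T' i = rowsum T i.
  by move=> li; apply: eq_bigr => j _; rewrite tval_rcons s1 li.
have -> : rowsum T' n = \sum_(x <- k) x.
  by rewrite (big_nth 0) sk; apply: eq_bigr => j _; rewrite tval_rcons s1 ltnn eqxx.
(* For n = 0 there is no row above: [prevsum] is 0 and [a] is empty. *)
have -> : prevsum T' n = \sum_(x <- a) x.
  case: n a sa Ea {sk se s2 nz} s1 @T' Er => [|n] a sa Ea s1 T' Er.
    by rewrite (size0nil sa) big_nil.
  by rewrite /= Er // (big_nth 0) sa; apply: eq_bigr => j _; rewrite /Defs.tval -Ea.
have -> : alphasum T' n = \sum_(d <- e) (d.2 - d.1).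
  by rewrite (big_nth (0, 0)) se; apply: eq_bigr => j _; rewrite tdec_rcons s2 ltnn eqxx.
have -> : \prod_(0 <= j < n.+1) w (tdec T' n j).1 (tdec T' n j).2 =
          \prod_(d <- e) w d.1 d.2.
  by rewrite (big_nth (0, 0)) se; apply: eq_bigr => j _; rewrite tdec_rcons s2 ltnn eqxx.
have -> : \prod_(0 <= i < n) \prod_(0 <= j < i.+1) w (tdec T' i j).1 (tdec T' i j).2 =
          \prod_(0 <= i < n) \prod_(0 <= j < i.+1) w (tdec T i j).1 (tdec T i j).2.
  apply: eq_big_nat => i /andP[_ li]; apply: eq_bigr => j _.
  by rewrite tdec_rcons s2 li.
have -> : \prod_(0 <= i < n) X i ^ (rowsum T' i - prevsum T' i + alphasum T' i) =
          \prod_(0 <= i < n) X i ^ (rowsum T i - prevsum T i + alphasum T i).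
  apply: eq_big_nat => i /andP[_ li]; congr (_ ^ (_ - _ + _)); first exact: Er.
    by case: i li => //= i /ltnW; apply: Er.
  by apply: eq_bigr => j _; rewrite tdec_rcons s2 li.
rewrite [_ - _ + _]addrAC [X n ^ (_ + _ - _)](expfzDr _ _ nz); ring.
Qed.

Lemma sum_triangles n k : size k = n -> (forall i, (i < n)%N -> X i != 0) ->
  \sum_(T <- triangles n k) gsign R n T * gweight w X n T = gf_rec X U wt n k.
Proof.
elim: n k => [|n IH] k sk X0.
  by rewrite big_seq1 /gsign /gweight !big_geq // expr0 !mul1r.
rewrite /triangles -/triangles big_allpairs_dep [RHS]/=.
rewrite -[X in _ = \sum_(e <- X) _]/(choices (nseq n.+1 U)).
apply: eq_big_seq => e he; rewrite big_allpairs_dep.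
have se : size e = n.+1 by rewrite (size_choices he) size_nseq.
rewrite -sum_choices_sint_list !mulr_sumr; apply: eq_big_seq => a ha.
have sa : size a = n by rewrite (size_choices ha) size_map; apply: size_deco_intervals.
rewrite -IH //; last by move=> i /ltnW; apply: X0.
rewrite !mulr_sumr; apply: eq_big_seq => T.
rewrite mem_triangles // => /(geamt_specP _ sa) [s1 s2 _ s4 _].
rewrite gsign_rcons // (gweight_rcons (a := a)) ?X0 //; ring.
Qed.

End Triangles.

(** * Schur polynomials as alternating functions *)

Lemma nth_shift_idx c k j : (j < size k)%N -> nth 0 (shift_idx c k) j = nth 0 k j + (c + j%:Z).
Proof.
elim: k c j => [//|x k IH] c [|j] /= jk; first by lia.
by rewrite IH // -addrA -intS.
Qed.

Lemma size_adjacent z k : size (adjacent z k) = size k.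
Proof. by elim: k z => //= y k IH z; rewrite IH. Qed.

Lemma nth_adjacent z k j : (j < size k)%N ->
  nth (0, 0) (adjacent z k) j = (nth 0 (z :: k) j, nth 0 k j).
Proof. by elim: k z j => [//|y k IH] z [|j] //= jk; rewrite IH. Qed.

Lemma adjacentE z k : adjacent z k = deco_adj z k (nseq (size k) (0, 0)).
Proof. by elim: k z => //= y k IH z; rewrite subr0 IH. Qed.

(** Consecutive entries of [a] are separated by an entry of [k]; keeping the lower bound [x] makes
    the induction work. *)
Lemma sorted_interlacing x k a :
  sorted <=%R (x :: k) -> a \in choices [seq zint i.1 i.2 | i <- adjacent x k] ->
  path <=%R x a.
Proof.
elim: k x a => [|y k IH] x a /=; first by rewrite inE => _ /eqP->.
case/andP => xy yk /allpairsPdep[b [a' [hb ha' ->]]] /=.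
move: hb; rewrite /zint xy => /mapP[i]; rewrite mem_iota => li eb.
have [xb yb] : x <= b /\ b <= y by lia.
rewrite xb /=; have := IH y a' yk ha'; case: a' {ha'} => //= c a' /andP[yc ->].
by rewrite (le_trans yb yc).
Qed.

Section SumChoices.
Variables (V : nmodType) (T : Type).
Implicit Types (F : seq T -> V) (l : seq T) (ls : seq (seq T)).

Lemma sum_choices_rcons ls l F :
  \sum_(a <- choices (rcons ls l)) F a = \sum_(a <- choices ls) \sum_(x <- l) F (rcons a x).
Proof.
elim: ls F => [|l' ls IH] F /=.
  rewrite big_seq1 big_flatten big_map.
  by apply: eq_bigr => x _; rewrite big_seq1.
by rewrite !big_allpairs_dep; apply: eq_bigr => x _; rewrite IH.
Qed.

(** Serves to pass between the decreasing rows of [gt_sum] and the increasing rows of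
    [alt_schur]. *)
Lemma sum_choices_rev ls F :
  \sum_(a <- choices (rev ls)) F (rev a) = \sum_(a <- choices ls) F a.
Proof.
elim: ls F => [|l ls IH] F; first by rewrite !big_seq1.
rewrite rev_cons sum_choices_rcons /= big_allpairs_dep.
under [RHS]eq_bigr => x _ do rewrite -IH.
rewrite exchange_big; apply: eq_bigr => a _; apply: eq_bigr => x _.
by rewrite rev_rcons.
Qed.

End SumChoices.

Fixpoint inv_count (v : seq int) : nat :=
  if v is x :: v' then (\sum_(y <- v') (x < y)%R + inv_count v')%N else 0%N.

Lemma inv_countE v : inv_count v =
  (\sum_(0 <= i < size v) \sum_(i.+1 <= j < size v)
     nat_of_bool (nth (0:int) v i < nth (0:int) v j)%R)%N.
Proof.
elim: v => [|x v IH] /=; first by rewrite big_geq.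
rewrite big_nat_recl // IH; congr (_ + _)%N.
  by rewrite big_add1 /= (big_nth 0).
by apply: eq_bigr => i _; rewrite [RHS]big_add1.
Qed.

Definition gei := fun a b : int => b <= a.

Lemma gei_trans : transitive gei.
Proof. by move=> a b c; rewrite /gei => ab ca; apply: le_trans ca ab. Qed.

Lemma gei_total : total gei.
Proof. by move=> a b; rewrite /gei; apply: le_total. Qed.

Lemma gei_anti : antisymmetric gei.
Proof. by move=> a b; rewrite /gei andbC; apply: le_anti. Qed.

(** Inserting [x] into the sorted tail moves it past exactly the larger entries, which are the
    inversions it contributes. Both equations hold because a sorted list is determined by its
    multiset of entries. *)
Lemma sort_gei_cons x v (s := sort gei v) :
  s = [seq y <- s | x < y] ++ [seq y <- s | ~~ (x < y)] /\
  sort gei (x :: v) = [seq y <- s | x < y] ++ x :: [seq y <- s | ~~ (x < y)].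
Proof.
have ss : pairwise gei s.
  by rewrite -sorted_pairwise; [apply/sort_sorted/gei_total | apply: gei_trans].
have H1 : pairwise gei [seq y <- s | x < y] by apply: pairwise_filter.
have H2 : pairwise gei [seq y <- s | ~~ (x < y)] by apply: pairwise_filter.
split; apply: (sorted_eq gei_trans gei_anti).
- exact/sort_sorted/gei_total.
- rewrite sorted_pairwise; last exact: gei_trans.
  rewrite pairwise_cat H1 H2 !andbT; apply/allrelP => y z.
  rewrite !mem_filter -leNgt => /andP[xy _] /andP[zx _].
  exact: (le_trans zx (ltW xy)).
- by rewrite perm_sym; apply/permPl/perm_filterC.
- exact/sort_sorted/gei_total.
- rewrite sorted_pairwise; last exact: gei_trans.
  rewrite pairwise_cat H1 /= H2 andbT; apply/andP; split.
    apply/allrelP => y z; rewrite mem_filter inE => /andP[xy _] /orP[/eqP->|].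
      exact: ltW.
    rewrite mem_filter -leNgt => /andP[zx _].
    exact: le_trans zx (ltW xy).
  by apply/allP => z; rewrite mem_filter -leNgt => /andP[].
- rewrite perm_sort perm_sym -cat1s perm_catCA /= perm_cons.
  apply: (perm_trans (y := s)); first exact/permPl/perm_filterC.
  by rewrite perm_sort.
Qed.

Section AltSort.
Variable R : comNzRingType.
Implicit Types (g : seq int -> R) (p q v : seq int).

Lemma alt_move g x p q : alt g -> g (x :: p ++ q) = (-1) ^+ size p * g (p ++ x :: q).
Proof.
elim: p g => [|y p IH] g ag /=; first by rewrite expr0 mul1r.
rewrite (proj1 (ag [::] _)) /= (IH (fun v => g (y :: v))); last exact: alt_cons.
by rewrite exprS mulN1r mulNr.
Qed.

Lemma alt_sort g v : alt g -> g v = (-1) ^+ inv_count v * g (sort gei v).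
Proof.
elim: v g => [|x v IH] g ag; first by rewrite expr0 mul1r.
rewrite (IH (fun v => g (x :: v))) /=; last exact: alt_cons.
have [E1 E2] := sort_gei_cons x v.
rewrite [in LHS]E1 alt_move // E2 mulrA -exprD addnC; congr (_ ^+ (_ + _) * _).
rewrite size_filter -sum1_count big_mkcond /= (perm_big v) ?perm_sort //.
Qed.

(** A repeated entry can be moved next to its copy, where the diagonal condition of [alt2]
    applies. *)
Lemma alt_not_uniq g v : alt g -> ~~ uniq v -> g v = 0.
Proof.
elim: v g => [//|x v IH] g ag /=.
rewrite negb_and negbK => /orP[|nu]; last first.
  by apply: (IH (fun v => g (x :: v))) nu; apply: alt_cons.
case/splitPr => p q; rewrite alt_move // (proj2 (ag p q)) mulr0 //.
Qed.

End AltSort.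

Section Schur.
Variables (R : fieldType) (X : nat -> R).

(** On an increasing row no signed interval is negative, so the branching rule becomes the
    Gelfand-Tsetlin recursion. *)
Lemma gt_sum_alt_schur n k : size k = n -> sorted <=%R k -> (forall i, (i < n)%N -> X i != 0) ->
  gt_sum X n (rev k) = alt_schur X n (shift_idx 0 k).
Proof.
elim: n k => [|n IH] k sk ko X0; first by rewrite (size0nil sk).
have nz : X n != 0 by apply: X0.
case: k sk ko => // x k [sk] ko.
rewrite [LHS]/= cprodE -sum_choices_rev -map_rev.
have -> : [seq zint (nth 0 (rev (x :: k)) j.+1) (nth 0 (rev (x :: k)) j)
             | j <- rev (iota 0 n)] = [seq zint i.1 i.2 | i <- adjacent x k].
  apply: (eq_from_nth (x0 := [::])).
    by rewrite !size_map size_rev size_iota size_adjacent sk.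
  move=> j; rewrite size_map size_rev size_iota => jn.
  rewrite (nth_map 0%N) ?size_rev ?size_iota // (nth_map (0, 0)) ?size_adjacent ?sk //.
  rewrite nth_adjacent ?sk // nth_rev ?size_iota // nth_iota; last by lia.
  rewrite !nth_rev /= ?sk; try lia.
  have -> : (n.+1 - (0 + (n - j.+1)).+2 = j)%N by lia.
  by have -> : (n.+1 - (0 + (n - j.+1)).+1 = j.+1)%N by lia.
transitivity (\sum_(a <- choices [seq zint i.1 i.2 | i <- adjacent x k])
    X n ^ (\sum_(z <- x :: k) z - \sum_(z <- a) z) * alt_schur X n (shift_idx 0 a)).
  apply: eq_big_seq => a ha.
  have sa : size a = n by rewrite (size_choices ha) size_map size_adjacent.
  rewrite !(perm_big _ (permEl (perm_rev _))) IH //; last by move=> i /ltnW; apply: X0.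
  exact: path_sorted (sorted_interlacing ko ha).
have -> : [seq zint i.1 i.2 | i <- adjacent x k] = [seq sint_list i | i <- adjacent x k].
  apply/eq_in_map => i; elim: (k) (x) ko => //= y k' IHk z /andP[zy yk].
  rewrite inE => /orP[/eqP->|]; last exact: IHk.
  by rewrite /sint_list /sint zy /= cats0.
have sneg : (\sum_(i <- adjacent x k) sint_neg i.1 i.2 = 0)%N.
  elim: (k) (x) ko => [|y k' IHk] z /=; first by rewrite big_nil.
  by case/andP => zy yk; rewrite big_cons IHk // /sint_neg /sint /= zy.
pose F a := X n ^ (\sum_(z <- x :: k) z - \sum_(z <- a) z) * alt_schur X n (shift_idx 0 a).
transitivity ((-1) ^+ (\sum_(i <- adjacent x k) sint_neg i.1 i.2)%N *
  \sum_(a <- choices [seq sint_list i | i <- adjacent x k]) F a).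
  by rewrite sneg mul1r.
rewrite sum_choices_sint_list [shift_idx 0 _]/= alt_schurS ?size_shift_idx //.
set N := \sum_(i < n) (0 + i%:Z : int).
(* Interlacing is the case of decorations (0, 0), which brings [box_sum_shift_idx] into play. *)
rewrite -(finlin_scale _ _ (finlin_box_sum _ _)) adjacentE [in RHS]adjacentE size_shift_idx.
rewrite -(box_sum_shift_idx 0 (fun v => _ * (X n ^ (- \sum_(x <- v) x) * alt_schur X n v)) (erefl _)).
apply: (finlin_ext (finlin_box_sum _ _)) => v.
rewrite size_map -adjacentE size_adjacent sk => sv; rewrite /F mulrA -(expfzDr _ _ nz).
congr (_ ^ _ * _).
have := sum_shift_idx 0 (x :: k); rewrite /= big_cons => ->.
by rewrite sum_shift_idx sv big_cons /= sk big_ord_recr /=; ring.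
Qed.

(** Sorting costs the sign of the permutation on both sides, a repetition gives 0 on both, and
    translation by [p] is compensated by the negative powers of the variables. *)
Lemma ext_schur_alt_schur k : (forall i, (i < size k)%N -> X i != 0) ->
  ext_schur X (rev k) = alt_schur X (size k) (shift_idx 0 k).
Proof.
move=> X0; rewrite /ext_schur size_rev; set n := size k; set v := [seq _ | i <- _].
set p : int := Num.max _ _.
(* With lambda = [rev k], lambda_i - i equals K_(n-i) - n, positions of K being counted from 0;
   hence the reversal and the [+ n%:Z]. *)
pose g v := alt_schur X n [seq x + n%:Z | x <- rev v].
have ag : alt g.
  move=> u u'; rewrite /g; have [H1 H2] := alt_alt_schur X n [seq x + n%:Z | x <- rev u']
    [seq x + n%:Z | x <- rev u].
  split=> [a b|a]; rewrite rev_cat !rev_cons !cat_rcons map_cat /=;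
    [rewrite H1|exact: H2].
  by rewrite rev_cat !rev_cons !cat_rcons map_cat.
have sv : size v = n by rewrite size_map size_iota.
have gv : alt_schur X n (shift_idx 0 k) = g v.
  congr alt_schur; apply: (eq_from_nth (x0 := 0)); first by rewrite size_shift_idx size_map size_rev sv.
  move=> j; rewrite size_shift_idx => jk; rewrite nth_shift_idx // (nth_map 0) ?size_rev ?sv //.
  rewrite nth_rev ?sv // (nth_map 0%N) ?size_iota; last by lia.
  rewrite nth_iota; last by lia.
  rewrite nth_rev -/n; last by lia.
  have -> : (n - (0 + (n - j.+1)).+1 = j)%N by lia.
  by lia.
rewrite gv; case: ifPn => [nu|/negPn uv]; first by rewrite alt_not_uniq.
rewrite (alt_sort v ag) inv_countE sv -/gei; set s := sort gei v.
rewrite -mulrA; congr (_ * _).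
have ss : size s = n by rewrite size_sort.
have us : uniq s by rewrite sort_uniq.
have so : sorted gei s by apply/sort_sorted/gei_total.
set mu := [seq _ | i <- iota 0 n].
have smu : size mu = n by rewrite size_map size_iota.
have nmu i : (i < n)%N -> nth 0 mu i = nth 0 s i + (i.+1)%:Z + p.
  by move=> li; rewrite (nth_map 0%N) ?size_iota // nth_iota.
rewrite /schur smu -[mu]revK gt_sum_alt_schur ?size_rev //; last first.
  rewrite rev_sorted; apply/(sortedP 0) => i; rewrite smu => li.
  rewrite !nmu //; last exact: ltnW.
  have := sortedP 0 so i; rewrite ss => /(_ li); rewrite /gei => le1.
  (* Distinctness makes [s] strictly decreasing, so adding the index still leaves [mu] weakly
     decreasing. *)
  have : nth 0 s i != nth 0 s i.+1 by rewrite nth_uniq ?ss ?(ltnW li) // neq_ltn ltnSn.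
  lia.
have -> : shift_idx 0 (rev mu) = [seq x + p | x <- [seq x + n%:Z | x <- rev s]].
  apply: (eq_from_nth (x0 := 0)); first by rewrite size_shift_idx !size_map !size_rev smu ss.
  move=> j; rewrite size_shift_idx size_rev smu => jn.
  rewrite nth_shift_idx ?size_rev ?smu // nth_rev ?smu // nmu; last by lia.
  rewrite (nth_map 0) ?size_map ?size_rev ?ss // (nth_map 0) ?size_rev ?ss //.
  rewrite nth_rev ?ss //; lia.
rewrite alt_schur_shift ?size_map ?size_rev // mulrC mulrA -big_split big1_seq ?mul1r //=.
move=> i; rewrite mem_index_iota => /andP[_ li].
by rewrite -(expfzDr _ _ (X0 i li)) addNr.
Qed.

End Schur.

(** * The operator product over pairs of positions in recursive form *)

Lemma addAt_cons x k p d : addAt (x :: k) p.+1 d = x :: addAt k p d.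
Proof.
rewrite /addAt /mkseq /= addr0 -[1%N]/(1 + 0)%N iotaDl -map_comp.
by congr (_ :: _); apply: eq_map => j.
Qed.

Lemma addAt_cons0 x k d : addAt (x :: k) 0 d = x + d :: k.
Proof.
rewrite /addAt /mkseq /= -[1%N]/(1 + 0)%N iotaDl -map_comp; congr (_ :: _).
by rewrite -[RHS](mkseq_nth 0); apply: eq_map => j /=; rewrite addr0.
Qed.

Lemma addAt_cat u y v d : addAt (u ++ y :: v) (size u) d = u ++ y + d :: v.
Proof. by elim: u => [|x u IH] /=; rewrite ?addAt_cons0 // addAt_cons IH. Qed.

Lemma pairsS n : pairs n.+1 =
  [seq (0%N, q) | q <- iota 1 n] ++ [seq (p.1.+1, p.2.+1) | p <- pairs n].
Proof.
rewrite /pairs /= subn1 /=; congr (_ ++ _).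
have -> : iota 1 n = [seq p.+1 | p <- iota 0 n] by rewrite (iotaDl 1 0).
rewrite map_flatten -!map_comp; congr flatten.
apply: eq_map => p /=.
by rewrite subSS -[p.+2]/(1 + p.+1)%N iotaDl -!map_comp; apply: eq_map.
Qed.

Section OpProd.
Variables (R : comNzRingType) (S : seq (int * int)) (w : int -> int -> R).
Local Notation U := (undup S).
Local Notation wt := (fun d : int * int => w d.1 d.2).
Implicit Types (F : seq int -> R) (u v K : seq int).

(** [u] holds the entries already acted on, which keeps list positions in step with the indices
    q. *)
Lemma foldr_pairOp_head x u K F :
  foldr (fun pq g => pairOp S w pq.1 pq.2 g) F
    [seq (0%N, q) | q <- iota (size u).+1 (size K)] (x :: u ++ K) =
  head_op U wt x K (fun p => F (p.1 :: u ++ p.2)).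
Proof.
elim: K x u => [//|y K IH] x u /=.
rewrite /pairOp; apply: eq_bigr => d _; congr (_ * _).
rewrite addAt_cons0 addAt_cons addAt_cat -cat_rcons -[(size u).+2](congr1 succn (size_rcons u (y - d.1))).
rewrite IH; apply: (finlin_ext (finlin_head_op _ _ _ _)) => p _.
by rewrite cat_rcons.
Qed.

Lemma foldr_pairOp_tail x K F (ps : seq (nat * nat)) :
  foldr (fun pq g => pairOp S w pq.1 pq.2 g) F
    [seq (p.1.+1, p.2.+1) | p <- ps] (x :: K) =
  foldr (fun pq g => pairOp S w pq.1 pq.2 g) (fun v => F (x :: v)) ps K.
Proof.
elim: ps K => [//|p ps IH] K /=.
by apply: eq_bigr => d _; rewrite !addAt_cons IH.
Qed.

Lemma opProd_op_prod n K F : size K = n -> opProd S w n F K = op_prod U wt n F K.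
Proof.
elim: n K F => [|n IH] [|x K] F // [sK].
rewrite /opProd pairsS foldr_cat -sK (foldr_pairOp_head x [::] K) /=.
apply: (finlin_ext (finlin_head_op _ _ _ _)) => -[a v] /= sv.
by rewrite foldr_pairOp_tail sK -IH ?sv.
Qed.

End OpProd.

Section OpShl.
Variables (R : comNzRingType) (U : seq (int * int)) (w : int * int -> R).

Lemma head_op_shift_idx x (b c : int) K (F : int * seq int -> R) :
  head_op U w x K (fun p => F (p.1 + b, shift_idx c p.2)) = head_op U w (x + b) (shift_idx c K) F.
Proof.
elim: K x c F => [//|y K IH] x c F /=; apply: eq_bigr => d _; congr (_ * _).
rewrite [x + b + _]addrAC -(IH _ _ (fun p => F (p.1, y + c - d.1 :: p.2))).
by apply: (finlin_ext (finlin_head_op _ _ _ _)) => p _ /=; rewrite [y + c - _]addrAC.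
Qed.

(** Shift operators are translation invariant, so they act alike in the coordinates k_j and K_j. *)
Lemma op_prod_shift_idx n c K F : size K = n ->
  op_prod U w n (fun v => F (shift_idx c v)) K = op_prod U w n F (shift_idx c K).
Proof.
elim: n c K F => [|n IH] c [|x K] F //= [sK].
rewrite -head_op_shift_idx; apply: (finlin_ext (finlin_head_op _ _ _ _)) => -[a v] /= sv.
by rewrite -(IH _ _ (fun z => F (a + c :: z))) // sv.
Qed.

End OpShl.

(** * The generating function as an operator applied to a Schur polynomial *)

Theorem mainTheorem9 (R : fieldType) (S : seq (int * int)) (w : int -> int -> R)
    (X : nat -> R) (k : seq int) :
  (forall s t : int, (s, t) \notin S -> w s t = 0) ->
  (forall i : nat, (i < size k)%N -> X i != 0) ->
  gf_is (fun T : triangle => GEAMT k T && supported S (size k) T)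
        (fun T => gsign R (size k) T * gweight w X (size k) T)
        (rhs S w X k).
Proof.
move=> _ X0.
have mem_t T : (T \in triangles S (size k) k) = GEAMT k T && supported S (size k) T.
  exact: mem_triangles.
have uniq_t : uniq (triangles S (size k) k) by apply: uniq_triangles.
split; first by exists (triangles S (size k) k).
move=> L uL memL.
have /(perm_big _) -> : perm_eq L (triangles S (size k) k).
  by apply: uniq_perm => // T; rewrite memL mem_t.
rewrite sum_triangles // gf_rec_op_prod // /rhs opProd_op_prod //; congr (_ * _).
(* The operators evaluate only at lists as long as [k], where [ext_schur] and [alt_schur] agree. *)
rewrite -op_prod_shift_idx //; apply: (finlin_ext (finlin_op_prod _ _ (erefl _))) => v sv.
by rewrite ext_schur_alt_schur sv.
Qed.
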